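(* Let $m\geq 1$, let $M\subseteq\mathbb{E}^{m+1}$ be a hyperovaloid, and let $f:\mathbb{R}\rightarrow\mathbb{R}$ be an increasing function. If either $H_{\mathrm{II}}=\frac{m}{2}H+f(\det A)$ holds at every point of $M$, or $H_{\mathrm{II}}=H\,f(\det A)$ holds at every point of $M$, then $M$ is a hypersphere.
   Context: $\mathbb{E}^{m+1}$ is the $(m+1)$-dimensional Euclidean space with scalar product $\langle\cdot,\cdot\rangle$ and standard connection $\overline{\mathrm{D}}$. Hypersurfaces are smooth and connected. For a hypersurface $M\subseteq\mathbb{E}^{m+1}$ with unit normal vector field $N$, the shape operator is $A(V)=-\overline{\mathrm{D}}_V N$, the second fundamental form is $\mathrm{II}(V,W)=\langle A(V),W\rangle$, and the mean curvature is $H=\frac{1}{m}\mathrm{trace}\,A$. $M$ is called locally strongly convex if $\mathrm{II}$ is positive-definite. A hyperovaloid is a compact (without boundary), locally strongly convex hypersurface of $\mathbb{E}^{m+1}$; on it $N$ is chosen to be the interior unit normal, which makes $\mathrm{II}$ positive-definite. Then $(M,\mathrm{II})$ is a Riemannian manifold; $\Delta_{\mathrm{II}}$ denotes its Laplacian, with the sign convention that the Laplacian is the trace of the Hessian operator $V\mapsto\nabla_V(\mathrm{grad}\,\cdot)$. The mean curvature of the second fundamental form is the function $H_{\mathrm{II}}=\frac{m}{2}H+\frac{1}{4}\Delta_{\mathrm{II}}(\log\det A)$. A hypersphere is a round Euclidean hypersphere of some centre and radius. *)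

(* Defs.v *)
From HB Require Import structures.
From mathcomp Require Import all_boot all_order all_algebra.
From mathcomp Require Import all_classical all_reals all_analysis.

Set Implicit Arguments.
Unset Strict Implicit.
Unset Printing Implicit Defensive.
Import Order.TTheory GRing.Theory Num.Theory.
Import numFieldNormedType.Exports.
Local Open Scope classical_set_scope.
Local Open Scope ring_scope.

(* Euclidean (m+1)-space is 'rV[R]_m.+1 with the scalar product [dotv]. The
   norm that the library puts on 'rV[R]_n is the sup norm; it is used only
   through the topology and the notion of differentiability it induces. *)

(* A tangent vector at the point of parameter x is represented by its row v of
   coordinates; the vector itself is v *m 'J X x. Accordingly, the matrix of an
   endomorphism acts on coordinate rows from the right: its i-th row holds the
   coordinates of the image of the i-th coordinate vector field. *)

Section Calculus.
Variable R : realType.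

Definition dotv n (u v : 'rV[R]_n) : R := (u *m v^T) 0 0.

(* C^oo on an open set U: all iterated directional derivatives, of every order
   (including 0), are differentiable at every point of U. *)
Definition smooth_on m n (U : set 'rV[R]_m) (f : 'rV[R]_m -> 'rV[R]_n) : Prop :=
  forall (vs : seq 'rV[R]_m) (x : 'rV[R]_m), U x ->
    differentiable (foldr (fun v g => 'D_v g) f vs) x.

Definition partial m (i : 'I_m) (u : 'rV[R]_m -> R) (x : 'rV[R]_m) : R :=
  'D_(delta_mx 0 i) u x.

End Calculus.

(* Riemannian metric on an open set of coordinates, given by its Gram matrix. *)
Section RiemannianMetric.
Variables (R : realType) (m : nat) (g : 'rV[R]_m -> 'M[R]_m).

(* The coefficient Gamma^k_{ij} of the Levi-Civita connection. *)
Definition christoffel (k i j : 'I_m) (x : 'rV[R]_m) : R :=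
  2^-1 * \sum_l invmx (g x) k l *
    (partial i (fun y => g y j l) x + partial j (fun y => g y i l) x
     - partial l (fun y => g y i j) x).

Definition gradient (u : 'rV[R]_m -> R) (x : 'rV[R]_m) : 'rV[R]_m :=
  \row_k \sum_l invmx (g x) k l * partial l u x.

(* Row i: the covariant derivative of the vector field V along the i-th
   coordinate vector field. *)
Definition covariant_derivative (V : 'rV[R]_m -> 'rV[R]_m) (x : 'rV[R]_m) :
    'M[R]_m :=
  \matrix_(i, k) (partial i (fun y => V y 0 k) x
                  + \sum_j christoffel k i j x * V x 0 j).

Definition hessian_operator (u : 'rV[R]_m -> R) (x : 'rV[R]_m) : 'M[R]_m :=
  covariant_derivative (gradient u) x.

Definition laplacian (u : 'rV[R]_m -> R) (x : 'rV[R]_m) : R :=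
  \tr (hessian_operator u x).

End RiemannianMetric.

Section Hypersurface.
Variables (R : realType) (m : nat).
Implicit Types (M : set 'rV[R]_m.+1) (N : 'rV[R]_m.+1 -> 'rV[R]_m.+1).
Implicit Types (U : set 'rV[R]_m) (X : 'rV[R]_m -> 'rV[R]_m.+1).

(* X restricted to U is a smooth immersion and a homeomorphism onto a relatively
   open subset of M; the last clause says that it maps the open subsets of U to
   relatively open subsets of M. *)
Definition local_parametrization M U X : Prop :=
  [/\ open U,
      smooth_on U X,
      forall x, U x -> row_free ('J X x),
      {in U &, injective X} &
      forall V, open V -> V `<=` U -> exists2 W, open W & X @` V = M `&` W].

(* Connected embedded hypersurface without boundary; the empty set is excluded
   as the library counts it as connected. *)
Definition hypersurface M : Prop :=
  [/\ M !=set0, connected M &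
      forall p, M p -> exists U X, local_parametrization M U X /\ (X @` U) p].

(* Only the values of N on M matter. *)
Definition unit_normal_field M N : Prop :=
  forall U X, local_parametrization M U X ->
    smooth_on U (N \o X) /\
    forall x, U x -> dotv (N (X x)) (N (X x)) = 1 /\
                     (forall v, dotv (v *m 'J X x) (N (X x)) = 0).

(* A(V) = - D_V N: multiplying by [pinvmx ('J X x)] takes the coordinates, in
   the basis formed by the rows of 'J X x, of the tangent vectors that are the
   rows of - 'J (N \o X) x. *)
Definition shape_operator N X (x : 'rV[R]_m) : 'M[R]_m :=
  - 'J (N \o X) x *m pinvmx ('J X x).

Definition second_fundamental_form N X (x : 'rV[R]_m) : 'M[R]_m :=
  \matrix_(i, j) dotv (row i (shape_operator N X x) *m 'J X x)
                      (row j ('J X x)).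

Definition mean_curvature N X (x : 'rV[R]_m) : R :=
  m%:R^-1 * \tr (shape_operator N X x).

Definition mean_curvature_II N X (x : 'rV[R]_m) : R :=
  m%:R / 2 * mean_curvature N X x
  + 4^-1 * laplacian (second_fundamental_form N X)
                     (fun y => ln (\det (shape_operator N X y))) x.

Definition locally_strongly_convex M N : Prop :=
  forall U X x, local_parametrization M U X -> U x ->
    forall v : 'rV[R]_m, v != 0 ->
      0 < dotv (v *m second_fundamental_form N X x) v.

(* Replacing N by - N changes the sign of the second fundamental form, so on a
   connected M the last two conditions determine N on M: it is the interior
   unit normal. *)
Definition hyperovaloid M N : Prop :=
  [/\ hypersurface M, compact M, unit_normal_field M N &
      locally_strongly_convex M N].

Definition hypersphere M : Prop :=
  exists (c : 'rV[R]_m.+1) (r : R), 0 < r /\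
    M = [set p | dotv (p - c) (p - c) = r ^+ 2].

End Hypersurface.

(* Main.v *)
Require Import Defs.
From HB Require Import structures.
From mathcomp Require Import all_boot all_order all_algebra.
From mathcomp Require Import all_classical all_reals all_analysis.
From mathcomp Require Import perm ring lra.
Import Order.TTheory GRing.Theory Num.Theory.
Import numFieldNormedType.Exports.
Local Open Scope classical_set_scope.
Local Open Scope ring_scope.
Set Implicit Arguments.
Unset Strict Implicit.
Unset Printing Implicit Defensive.

(** Let [A] be the shape operator, [K = \det A] and [L] the Laplacian of the second
    fundamental form. By the definition of [mean_curvature_II], either hypothesis
    says that [L (ln K)] is, at each point, a positive multiple of [F K] for a
    nondecreasing function [F]: in the first case [F = f], in the second one
    [F = f - m / 2], with a factor that is positive because all principal
    curvatures are.

    First, [K] is constant. Where [K] is maximal, [L (ln K) <= 0]; where it is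
    minimal, [0 <= L (ln K)]. As [F] is monotone, [F K = 0] everywhere, so [ln K]
    is harmonic for [L], and Hopf's strong maximum principle ([strong_maximum])
    together with the connectedness of [M] makes it constant
    ([det_shape_constant]).

    Second, a closed convex hypersurface of constant [K] is umbilic. The proof is
    pointwise and replaces Minkowski's integral formulas by Simons' identity.
    Consider a point where the trace of [A] is maximal, in coordinates in which
    the first fundamental form is the identity up to first order and [A] is
    diagonal with entries [lam i]. Differentiating [\det A = K] twice, and using
    that the second derivatives of [\tr A] are nonpositive, one is led to
    [\sum (lam i - lam k) ^+ 2 <= 0] ([curvatures_equal], [umbilic_at_max],
    [shape_scalar_at_max]). So [A = mu I] at that point, and at any other point
    the trace is at most [m * mu] while the determinant is [mu ^+ m]; equality
    in the inequality between arithmetic and geometric means gives [A = mu I]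
    everywhere ([constant_det_umbilic]).

    Finally [N + mu p] is constant on [M], so that [M] lies on a sphere of
    radius [mu^-1], and the height functions show that it is the whole sphere
    ([umbilic_hypersphere]).

    Functions on [M] are only given in charts. That [\det A] and [\tr A] do not
    depend on the chart is proved without inverting a parametrization smoothly,
    by comparing two charts along a line in one of them
    ([normal_derivative_invariant], [shape_similar]); they then attain their
    extrema on the compact set [M] ([chart_max]). *)

(** * Bilinear algebra over the reals *)

Section ScalarProduct.
Variables (R : realType) (n : nat).
Implicit Types (u v w : 'rV[R]_n).

Lemma dotvE u v : dotv u v = \sum_i u 0 i * v 0 i.
Proof. by rewrite /dotv !mxE; apply: eq_bigr => i _; rewrite !mxE. Qed.

Lemma dotvC u v : dotv u v = dotv v u.
Proof. by rewrite !dotvE; apply: eq_bigr => i _; rewrite mulrC. Qed.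

Lemma dotvDl u v w : dotv (u + v) w = dotv u w + dotv v w.
Proof. by rewrite /dotv mulmxDl mxE. Qed.

Lemma dotvZl a u v : dotv (a *: u) v = a * dotv u v.
Proof. by rewrite /dotv -scalemxAl mxE. Qed.

Lemma dotvDr u v w : dotv u (v + w) = dotv u v + dotv u w.
Proof. by rewrite dotvC dotvDl !(dotvC u). Qed.

Lemma dotvZr a u v : dotv u (a *: v) = a * dotv u v.
Proof. by rewrite dotvC dotvZl dotvC. Qed.

Lemma dotvNl u v : dotv (- u) v = - dotv u v.
Proof. by rewrite -scaleN1r dotvZl mulN1r. Qed.

Lemma dotvNr u v : dotv u (- v) = - dotv u v.
Proof. by rewrite dotvC dotvNl dotvC. Qed.

Lemma dotv0l v : dotv 0 v = 0.
Proof. by rewrite /dotv mul0mx mxE. Qed.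

Lemma dotv0r v : dotv v 0 = 0.
Proof. by rewrite dotvC dotv0l. Qed.

Lemma dotv_ge0 u : 0 <= dotv u u.
Proof. by rewrite dotvE sumr_ge0 // => i _; rewrite -expr2 sqr_ge0. Qed.

Lemma dotv_eq0 u : (dotv u u == 0) = (u == 0).
Proof.
apply/idP/eqP => [|->]; last by rewrite dotv0l.
rewrite dotvE psumr_eq0 => [/allP u0|i _]; last by rewrite -expr2 sqr_ge0.
apply/rowP => i; rewrite mxE; apply/eqP; rewrite -sqrf_eq0 expr2.
exact: (implyP (u0 i (mem_index_enum i))).
Qed.

Lemma dotv_gt0 u : u != 0 -> 0 < dotv u u.
Proof. by move=> u0; rewrite lt_def dotv_eq0 u0 dotv_ge0. Qed.

End ScalarProduct.

Lemma dotv_mulmxl (R : realType) m n (A : 'M[R]_(m, n)) (u : 'rV_m)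
    (v : 'rV_n) : dotv (u *m A) v = dotv u (v *m A^T).
Proof. by rewrite /dotv trmx_mul trmxK mulmxA. Qed.

Section ContinuousDot.
Variables (R : realType) (T : topologicalType) (n : nat).

Lemma continuous_sum_fct (F : 'I_n -> T -> R) x :
  (forall i, {for x, continuous (F i)}) ->
  {for x, continuous (fun y => \sum_i F i y)}.
Proof.
move=> Fx; suff: {for x, continuous (\sum_i F i)}.
  by rewrite (_ : \sum_i F i = fun y => \sum_i F i y)// funeqE=> y; rewrite fct_sumE.
by elim/big_ind: _ => //= [|f g]; [exact: cst_continuous|exact: continuousD].
Qed.

Lemma continuous_dotv (f g : T -> 'rV[R]_n) x :
  {for x, continuous f} -> {for x, continuous g} ->
  {for x, continuous (fun y => dotv (f y) (g y))}.
Proof.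
move=> fx gx; under [X in {for x, continuous X}]eq_fun do rewrite dotvE.
apply: continuous_sum_fct => i.
by apply: continuousM; apply: (@continuous_comp _ _ _ _ (fun M : 'rV[R]_n => M 0 i)) => //;
  exact: coord_continuous.
Qed.

End ContinuousDot.

Lemma continuous_mulmxr (R : realType) m n (A : 'M[R]_(m, n)) (x : 'rV[R]_m) :
  {for x, continuous (mulmxr A : 'rV[R]_m -> 'rV[R]_n)}.
Proof.
apply/(@cvgrPdist_lt _ _ _ (nbhs x)) => e e0.
have cj (j : 'I_n) : \forall t \near x, `|(x *m A - t *m A) 0 j| < e.
  have cx : {for x, continuous (fun y : 'rV[R]_m => dotv (id y) (col j A)^T)}.
    by apply: continuous_dotv; [move=> ?|apply: cst_continuous].
  have /cvgrPdist_lt/(_ _ e0) := cx.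
  apply: filterS => t; rewrite !mxE !dotvE; congr (`|_ - _| < _);
  by apply: eq_bigr => i _; rewrite !mxE.
have {}cj : \forall t \near x, forall j, `|(x *m A - t *m A) 0 j| < e.
  by apply: (@filter_forall _ _ _ (nbhs x)).
apply: filterS cj => t tx.
rewrite /Num.Def.normr /= mx_normrE; apply/bigmax_ltP; split => //= -[i j] _ /=.
by rewrite ord1 (le_lt_trans _ (tx j))// !mxE.
Qed.

(** The equality case of the Cauchy-Schwarz inequality: with [w = u B], the
    value of the form at [u + t w] is [2 t |w|^2 + O(t^2)], which takes negative
    values unless [w = 0]. *)
Lemma posdef_semi (R : realType) n (B : 'M[R]_n) (u : 'rV[R]_n) :
  B^T = B -> (forall v : 'rV_n, 0 <= dotv (v *m B) v) ->
  dotv (u *m B) u = 0 -> u *m B = 0.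
Proof.
move=> Bsym B0 Buu; apply/eqP; rewrite -dotv_eq0; apply/eqP.
set w := u *m B.
pose c := dotv (w *m B) w.
have uw : dotv (w *m B) u = dotv w w by rewrite dotv_mulmxl Bsym.
have q t : 0 <= 2 * t * dotv w w + t ^+ 2 * c.
  have := B0 (u + t *: w).
  rewrite mulmxDl -scalemxAl !dotvDl !dotvDr !dotvZl !dotvZr Buu uw -/c -/w.
  by congr (_ <= _); ring.
have c0 : 0 <= c by apply: B0.
have w0 := dotv_ge0 w.
(* close to the minimum over [t]; the [+ 1] avoids dividing by [c = 0] *)
have := q (- (dotv w w) / (c + 1)).
have c1 : 0 < c + 1 by rewrite ltr_wpDl.
have -> : 2 * (- dotv w w / (c + 1)) * dotv w w + (- dotv w w / (c + 1)) ^+ 2 * c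
   = - (dotv w w ^+ 2 / (c + 1) ^+ 2 * (c + 2)) by field; rewrite gt_eqF.
rewrite oppr_ge0 pmulr_lle0 ?ltr_wpDl//.
rewrite pmulr_lle0 ?invr_gt0 ?exprn_gt0// => ww.
by apply/eqP; rewrite -sqrf_eq0 eq_le ww sqr_ge0.
Qed.

Lemma compact_sphere (R : realType) n :
  compact [set v : 'rV[R]_n | dotv v v = 1].
Proof.
apply: bounded_closed_compact.
  exists 1; split => // M M1 v /= v1.
  rewrite /Num.Def.normr /= mx_normrE; apply/bigmax_leP; split => /=.
    by rewrite ltW// (lt_trans _ M1).
  move=> [i j] _ /=; apply: le_trans (ltW M1).
  rewrite -(@expr_le1 _ 2)// real_normK ?num_real//.
  rewrite -v1 dotvE (bigD1 j)//= ord1 -expr2 lerDl.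
  by rewrite sumr_ge0// => k _; rewrite -expr2 sqr_ge0.
apply: (@preimage_closed _ _ (fun v : 'rV[R]_n => dotv v v) [set 1]).
  by move=> x _; apply: continuous_dotv; move=> ?.
exact: closed_eq.
Qed.

(** The quotient of the two forms attains its maximum [mu] on the Euclidean
    sphere; there [mu g - h] is positive semidefinite and vanishes on [u], so
    that [u] lies in its kernel. *)
Lemma pencil_eigenvector (R : realType) n (g h : 'M[R]_n.+1) :
  g^T = g -> h^T = h ->
  (forall v : 'rV_n.+1, v != 0 -> 0 < dotv (v *m g) v) ->
  exists (u : 'rV_n.+1) (mu : R), dotv (u *m g) u = 1 /\ u *m h = mu *: (u *m g).
Proof.
move=> gs hs gpos.
pose S := [set v : 'rV[R]_n.+1 | dotv v v = 1].
pose q v := dotv (v *m h) v / dotv (v *m g) v.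
have Sneq0 v : S v -> v != 0.
  move=> Sv; apply/eqP => v0; move: Sv; rewrite v0 /S /= dotv0l.
  by move=> /eqP; rewrite eq_sym oner_eq0.
have [||u] := @EVT_max_rV R _ q S _ (@compact_sphere R n.+1).
- exists (delta_mx 0 0); rewrite /S /= dotvE (bigD1 0)//= big1 => [|i i0].
    by rewrite mxE !eqxx addr0 mul1r.
  by rewrite mxE (negbTE i0) mul0r.
- apply: continuous_in_subspaceT => v; rewrite inE => Sv.
  have := @continuousM R _ (fun v : 'rV[R]_n.+1 => dotv (v *m h) v)
    (fun v => (dotv (v *m g) v)^-1) v; apply.
    by apply: continuous_dotv; [exact: continuous_mulmxr|move=> ?].
  apply: continuousV; first by rewrite gt_eqF// gpos// Sneq0.
  by apply: continuous_dotv; [exact: continuous_mulmxr|move=> ?].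
rewrite inE => Su umax.
have u0 := Sneq0 _ Su.
pose mu := q u.
have mumax v : dotv (v *m h) v <= mu * dotv (v *m g) v.
  have [->|v0] := eqVneq v 0; first by rewrite !mul0mx !dotv0l mulr0.
  pose c := Num.sqrt (dotv v v).
  have c0 : 0 < c by rewrite sqrtr_gt0 dotv_gt0.
  have cc : c ^+ 2 = dotv v v by rewrite sqr_sqrtr// dotv_ge0.
  have Sw : S (c^-1 *: v).
    by rewrite /S /= dotvZl dotvZr -cc; field; rewrite gt_eqF.
  have := umax (c^-1 *: v); rewrite inE => /(_ Sw).
  rewrite -/mu /q ler_pdivrMr ?gpos ?Sneq0//.
  rewrite -!scalemxAl !dotvZl !dotvZr !(mulrCA mu).
  by rewrite !ler_pM2l ?invr_gt0.
have ker : u *m (mu *: g - h) = 0.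
  apply: posdef_semi => [|v|]; first by rewrite linearB linearZ /= gs hs.
    rewrite mulmxBr -scalemxAr dotvDl dotvNl dotvZl subr_ge0; exact: mumax.
  rewrite mulmxBr -scalemxAr dotvDl dotvNl dotvZl /mu /q divfK ?subrr//.
  by rewrite gt_eqF// gpos.
pose c := Num.sqrt (dotv (u *m g) u).
have c0 : 0 < c by rewrite sqrtr_gt0 gpos.
have cc : c ^+ 2 = dotv (u *m g) u by rewrite sqr_sqrtr// ltW// gpos.
exists (c^-1 *: u), mu; split.
  by rewrite -scalemxAl dotvZl dotvZr -cc; field; rewrite gt_eqF.
move: ker; rewrite mulmxBr -scalemxAr => /eqP; rewrite subr_eq0 => /eqP ker.
by rewrite -!scalemxAl -ker !scalerA mulrC.
Qed.

Lemma col_mx_form (R : realType) m1 m2 n (u : 'M[R]_(m1, n)) (w : 'M[R]_(m2, n))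
    (B : 'M[R]_n) :
  col_mx u w *m B *m (col_mx u w)^T =
  block_mx (u *m B *m u^T) (u *m B *m w^T) (w *m B *m u^T) (w *m B *m w^T).
Proof. by rewrite mul_col_mx tr_col_mx mul_col_row. Qed.

(** Induction on the dimension: a common eigenvector splits off, and the two
    forms are restricted to its [g]-orthogonal complement. *)
Lemma simultaneous_diagonalization (R : realType) n (g h : 'M[R]_n) :
  g^T = g -> h^T = h ->
  (forall v : 'rV_n, v != 0 -> 0 < dotv (v *m g) v) ->
  exists (P : 'M[R]_n) (d : 'rV[R]_n),
    P *m g *m P^T = 1%:M /\ P *m h *m P^T = diag_mx d.
Proof.
elim: n g h => [|n IH] g h gs hs gpos.
  by exists 1%:M, 0; split; apply/matrixP => -[].
have [u [mu [gu hu]]] := pencil_eigenvector gs hs gpos.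
pose K := kermx (g *m u^T).
have rK : \rank K = n.
  rewrite mxrank_ker.
  suff -> : \rank (g *m u^T) = 1%N by rewrite subn1.
  apply/eqP; rewrite eqn_leq rank_leq_col lt0n mxrank_eq0.
  apply: contra_eq_neq gu => gu0.
  by rewrite /dotv -mulmxA gu0 mulmx0 mxE eq_sym oner_neq0.
pose Q : 'M[R]_(n, n.+1) := castmx (rK, erefl) (row_base K).
have Qg : Q *m (g *m u^T) = 0.
  by apply/eqP; rewrite -sub_kermx /Q eqmx_cast eq_row_base.
have Qfree : row_free Q.
  by rewrite /row_free /Q eqmx_cast eq_row_base rK.
have [||v v0|P [d [Pg Ph]]] := IH (Q *m g *m Q^T) (Q *m h *m Q^T).
- by rewrite !trmx_mul trmxK gs mulmxA.
- by rewrite !trmx_mul trmxK hs mulmxA.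
- rewrite !mulmxA dotv_mulmxl trmxK; apply: gpos.
  apply: contra_neq v0 => vQ0; apply: (row_free_inj Qfree).
  by rewrite vQ0 mul0mx.
have gQ : u *m g *m Q^T = 0.
  by apply: trmx_inj; rewrite trmx0 !trmx_mul trmxK gs Qg.
have ugu : u *m g *m u^T = 1%:M.
  by apply/matrixP => i j; rewrite !ord1 -/(dotv _ _) gu mxE.
exists (col_mx u (P *m Q) : 'M[R]_(1 + n, 1 + n)), (row_mx mu%:M d); split.
  apply: etrans (col_mx_form u (P *m Q) g) _; apply: etrans _ (esym (@scalar_mx_block R 1 n 1)).
  congr block_mx => //.
  - by rewrite trmx_mul !mulmxA gQ mul0mx.
  - by rewrite -!mulmxA Qg mulmx0.
  - by rewrite trmx_mul !mulmxA in Pg *.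
have hut : h *m u^T = mu *: (g *m u^T).
  by rewrite -{1}hs -trmx_mul hu linearZ /= trmx_mul gs.
apply: etrans (col_mx_form u (P *m Q) h) _; apply: etrans _ (esym (@diag_mx_row _ n 1 mu%:M d)).
congr block_mx.
- by rewrite hu -scalemxAl ugu scale_scalar_mx mulr1; apply/matrixP => i j; rewrite !ord1 !mxE eqxx.
- by rewrite hu -scalemxAl trmx_mul !mulmxA gQ mul0mx scaler0.
- by rewrite -!mulmxA hut -!scalemxAr Qg mulmx0 scaler0.
- by rewrite trmx_mul !mulmxA in Ph *.
Qed.

(** * Iterated directional derivatives *)

Section NearEquality.
Variables (R : realType) (V W : normedModType R).

Lemma near_eq_differentiable (f g : V -> W) x :
  (\forall y \near x, f y = g y) -> differentiable f x -> differentiable g x.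
Proof.
move=> fg /diff_locallyP[dfc ef].
have fgx : f x = g x by apply: nbhs_singleton fg.
have eg : g \o shift x = cst (g x) + 'd f x +o_ 0 id.
  apply/eqaddoP => e e0; move/eqaddoP: ef => /(_ e e0).
  have fg0 : \forall h \near 0, f (h + x) = g (h + x).
    by rewrite (near_shift x) sub0r /=; apply: filterS fg => y /=; rewrite subrK.
  by apply: filterS2 fg0 => h /= fgh; rewrite !fctE /= fgh fgx.
by apply/diff_locallyP; rewrite (diff_unique dfc eg).
Qed.

End NearEquality.

Section Translation.
Variables (R : realType) (V W : normedModType R).
Implicit Types (f : V -> W) (x v c : V).

Lemma differentiable_translate f x c :
  differentiable f (x + c) -> differentiable (fun y => f (y + c)) x.
Proof.
by move=> df; apply: (@differentiable_comp _ _ _ _ (id + cst c) f).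
Qed.

Lemma derive_translate f x v c : 'D_v (fun y => f (y + c)) x = 'D_v f (x + c).
Proof.
rewrite /derive (_ : (fun h : R => h^-1 *: _) =
  (fun h : R => h^-1 *: ((f \o shift (x + c)) (h *: v) - f (x + c)))) //.
by apply/funext => h /=; rewrite addrA.
Qed.

Lemma derive_lincomb f x v w (a b : R) : differentiable f x ->
  'D_(a *: v + b *: w) f x = a *: 'D_v f x + b *: 'D_w f x.
Proof. by move=> df; rewrite !deriveE// linearD !linearZ. Qed.

Lemma derive_scale f x v (a : R) : differentiable f x ->
  'D_(a *: v) f x = a *: 'D_v f x.
Proof. by move=> df; rewrite !deriveE// linearZ. Qed.

End Translation.

Section LineDerivative.
Variables (R : realType) (V : normedModType R).
Implicit Types (f : V -> R) (x v w : V).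

Lemma is_derive_line f x v (s : R) :
  differentiable f (x + s *: v) ->
  is_derive s 1 (fun t : R => f (x + t *: v)) ('D_v f (x + s *: v)).
Proof.
move=> df.
have dl : is_diff s (fun t : R => x + t *: v) (fun t => t *: v).
  have -> : (fun t : R => t *: v) = 0 + ( *:%R^~ v) by rewrite add0r.
  exact: (@is_diffD _ _ _ (cst x) _ _ _ _ (is_diff_cst _ _) (is_diff_scalel _ _)).
have dfl : differentiable (f \o (fun t : R => x + t *: v)) s.
  by apply: differentiable_comp => //; apply: ex_diff.
apply: DeriveDef; first exact: diff_derivable.
have -> : 'D_1 (fun t : R => f (x + t *: v)) s = 'd f (x + s *: v) (1 *: v).
  by rewrite deriveE // (@diff_comp _ _ _ _ (fun t : R => x + t *: v) f s _ df) /= ?diff_val.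
by rewrite scale1r deriveE.
Qed.

Lemma line_MVT f x v (t : R) : 0 < t ->
  (forall s, 0 <= s <= t -> differentiable f (x + s *: v)) ->
  exists2 s, 0 < s < t & f (x + t *: v) - f x = t * 'D_v f (x + s *: v).
Proof.
move=> t0 df.
have [||s st] := @MVT R (fun s => f (x + s *: v)) (fun s => 'D_v f (x + s *: v)) 0 t t0.
- move=> s; rewrite in_itv /= => /andP[s0 st]; apply: is_derive_line.
  by apply: df; rewrite !ltW.
- apply: continuous_in_subspaceT => s; rewrite inE /= in_itv /= => st.
  have := is_derive_line (df _ st) => -[+ _].
  by move=> /derivable1_diffP/differentiable_continuous.
rewrite scale0r addr0 subr0 => ->; exists s; last by rewrite mulrC.
by move: st; rewrite in_itv.
Qed.

End LineDerivative.

Lemma differentiable_expansion (R : realType) (V W : normedModType R)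
    (f : V -> W) x (e : R) : 0 < e -> differentiable f x ->
  exists2 d : R, 0 < d &
    forall h : V, `|h| < d -> `|f (x + h) - f x - 'D_h f x| <= e * `|h|.
Proof.
move=> e0 df; have [_ ef] := (diff_locallyP _ _).1 df.
move/eqaddoP: ef => /(_ e e0) /nbhs_normP[d /= d0 dP].
exists d => // h hd; have := dP h; rewrite /= sub0r normrN => /(_ hd).
by rewrite !fctE /= deriveE// opprD addrA [h + x]addrC.
Qed.


Section SecondDerivatives.
Variables (R : realType) (V : normedModType R).
Implicit Types (f : V -> R) (x v w : V) (U : set V).

Lemma nbhs_small_segment x (U : set V) : nbhs x U ->
  exists2 d : R, 0 < d & forall h : V, `|h| < d -> U (x + h).
Proof.
move=> /nbhs_normP[d /= d0 dU]; exists d => // h hd; apply: dU.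
by rewrite /= opprD addrA subrr sub0r normrN.
Qed.

(** The mean value theorem, applied to [s |-> f (x + s v + t w) - f (x + s v)],
    turns the mixed second difference into an increment of ['D_v f]. *)
Lemma second_difference f x v w (e : R) : 0 < e ->
  (\forall y \near x, differentiable f y) -> differentiable ('D_v f) x ->
  exists2 d : R, 0 < d & forall t : R, 0 < t < d ->
    `|f (x + t *: v + t *: w) - f (x + t *: v) - f (x + t *: w) + f x
      - t ^+ 2 * 'D_w ('D_v f) x| <= e * t ^+ 2.
Proof.
move=> e0 df ddf.
pose N := `|v| + `|w| + 1.
have N0 : 0 < N by rewrite ltr_wpDl// addr_ge0.
have eN0 : 0 < e / (2 * N) by rewrite divr_gt0// mulr_gt0.
have [d1 d10 d1P] := differentiable_expansion eN0 ddf.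
have [d2 d20 d2P] := nbhs_small_segment df.
pose d := Num.min d1 d2.
have d0 : 0 < d by rewrite lt_min d10.
exists (d / N) => [|t /andP[t0 td]]; first exact: divr_gt0.
have small a b : 0 <= a <= t -> 0 <= b <= t -> `|a *: v + b *: w| <= t * N.
  move=> /andP[a0 at_] /andP[b0 bt]; rewrite (le_trans (ler_normD _ _))// !normrZ.
  rewrite !ger0_norm// /N !mulrDr mulr1 -[leLHS]addr0 lerD ?(ltW t0)//.
  by rewrite lerD// ler_wpM2r.
have tN : t * N < d by rewrite -ltr_pdivlMr.
have sd a b : 0 <= a <= t -> 0 <= b <= t -> `|a *: v + b *: w| < d.
  by move=> ha hb; rewrite (le_lt_trans (small _ _ ha hb)).
have tt : 0 <= t <= t by rewrite lexx ltW.
have z_t : 0 <= (0 : R) <= t by rewrite lexx ltW.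
have dfs a b : 0 <= a <= t -> 0 <= b <= t -> differentiable f (x + a *: v + b *: w).
  move=> ha hb; rewrite -addrA; apply: d2P.
  by rewrite (lt_le_trans (sd _ _ ha hb))// ge_min lexx orbT.
pose g y := f (y + t *: w) - f y.
have [s /andP[s0 st]] : exists2 s, 0 < s < t & g (x + t *: v) - g x =
    t * ('D_v f (x + s *: v + t *: w) - 'D_v f (x + s *: v)).
  have dg s : 0 <= s <= t -> differentiable f (x + s *: v + t *: w)
      /\ differentiable f (x + s *: v).
    move=> hs; split; first exact: dfs.
    by have := dfs s 0 hs z_t; rewrite scale0r addr0.
  have [s hs|s hs gE] := @line_MVT R V g x v t t0.
    have [d1s d2s] := dg s hs.
    by apply: differentiableB => //; exact: differentiable_translate.
  exists s => //; rewrite gE.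
  have [|d1s d2s] := dg s; first by case/andP: hs => *; rewrite !ltW.
  rewrite (_ : g = (fun y => f (y + t *: w)) - f) // deriveB.
  - by rewrite derive_translate.
  - by apply: diff_derivable; apply: differentiable_translate.
  - exact: diff_derivable.
rewrite /g => gE.
have hs : 0 <= s <= t by rewrite !ltW.
have -> : f (x + t *: v + t *: w) - f (x + t *: v) - f (x + t *: w) + f x =
  t * ('D_v f (x + s *: v + t *: w) - 'D_v f (x + s *: v)).
  by rewrite -gE; ring.
have lt1 : t * N < d1 by rewrite (lt_le_trans tN)// ge_min lexx.
have n1 := small _ _ hs tt.
have n2 : `|s *: v| <= t * N by have := small s 0 hs z_t; rewrite scale0r addr0.
have := d1P _ (le_lt_trans n1 lt1); rewrite derive_lincomb// addrA.
have := d1P _ (le_lt_trans n2 lt1); rewrite derive_scale//.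
set F := 'D_v f; rewrite /= => e2 e1.
have eN : e / (2 * N) * (t * N) = e / 2 * t by field; rewrite gt_eqF.
have {}e1 := le_trans e1 (ler_wpM2l (ltW eN0) n1).
have {}e2 := le_trans e2 (ler_wpM2l (ltW eN0) n2).
rewrite eN in e1 e2.
have -> : t * (F (x + s *: v + t *: w) - F (x + s *: v)) - t ^+ 2 * 'D_w F x =
  t * ((F (x + s *: v + t *: w) - F x - (s *: 'D_v F x + t *: 'D_w F x))
    - (F (x + s *: v) - F x - s *: 'D_v F x)).
  rewrite /GRing.scale /=.
  by move: (F _) (F _) (F x) ('D_v F x) ('D_w F x); move=> *; ring.
rewrite normrM gtr0_norm// (_ : e * t ^+ 2 = t * (e * t)); last by ring.
rewrite ler_wpM2l ?(ltW t0)// (le_trans (ler_normB _ _))//.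
by rewrite (le_trans (lerD e1 e2))// -mulrDl -splitr.
Qed.

(** The second difference is symmetric in [v] and [w], and after division by
    [t ^+ 2] it approaches both mixed derivatives. *)
Lemma derive_commute f x v w :
  (\forall y \near x, differentiable f y) ->
  differentiable ('D_v f) x -> differentiable ('D_w f) x ->
  'D_v ('D_w f) x = 'D_w ('D_v f) x.
Proof.
move=> df dv dw; set p := 'D_v ('D_w f) x; set q := 'D_w ('D_v f) x.
suff small (e : R) : 0 < e -> `|p - q| <= 2 * e.
  apply/eqP; rewrite -subr_eq0 -normr_le0; apply/ler_addgt0Pl => e e0.
  by have := small (e / 2); rewrite divr_gt0// mulrC divfK// addr0; apply.
move=> e0.
have [d1 d10 h1] := second_difference w e0 df dv.
have [d2 d20 h2] := second_difference v e0 df dw.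
pose t := Num.min d1 d2 / 2.
have t0 : 0 < t by rewrite divr_gt0// lt_min d10.
have tm : t < Num.min d1 d2 by rewrite ltr_pdivrMr// ltr_pMr ?lt_min ?d10// ltr1n.
move: tm; rewrite lt_min => /andP[td1 td2].
have := h1 t; rewrite t0 td1 => /(_ isT) {}h1.
have := h2 t; rewrite t0 td2 => /(_ isT) {}h2.
rewrite (addrAC x (t *: w) (t *: v)) -/p in h2; rewrite -/q in h1.
have t2 : 0 < t ^+ 2 by rewrite exprn_gt0.
rewrite -(ler_pM2l t2) -[X in X * `|_|]gtr0_norm// -normrM.
move: (f _) (f _) (f _) (f x) p q h1 h2 => c b a z p q h1 h2.
have -> : t ^+ 2 * (p - q) =
  (a - b - c + z - t ^+ 2 * q) - (a - c - b + z - t ^+ 2 * p) by ring.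
rewrite (le_trans (ler_normB _ _))//.
rewrite (_ : t ^+ 2 * (2 * e) = e * t ^+ 2 + e * t ^+ 2); last by ring.
exact: lerD.
Qed.

(** At a critical point with positive second derivative along [v], the first
    derivative is positive just after the point, and so the function grows. *)
Lemma second_derivative_at_max f x v :
  (\forall y \near x, differentiable f y) -> differentiable ('D_v f) x ->
  (\forall y \near x, f y <= f x) -> 'D_v f x = 0 /\ 'D_v ('D_v f) x <= 0.
Proof.
move=> df ddf fmax.
have [d1 d10 d1P] := nbhs_small_segment df.
have [d2 d20 d2P] := nbhs_small_segment fmax.
(* the mean value theorem would yield a value larger than [f x] *)
have nogrow u (d : R) : 0 < d ->
    (forall s, 0 < s < d -> 0 < 'D_u f (x + s *: u)) -> False.
  move=> d0 pos; pose n := `|u| + 1.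
  have n0 : 0 < n by rewrite ltr_wpDl.
  pose d' := Num.min (d1 / n) (Num.min (d2 / n) d).
  have d'0 : 0 < d' by rewrite !lt_min !divr_gt0.
  pose t := d' / 2.
  have t0 : 0 < t by rewrite divr_gt0.
  have td' : t < d' by rewrite ltr_pdivrMr// ltr_pMr// ltr1n.
  move: td'; rewrite !lt_min !ltr_pdivlMr// => /and3P[td1 td2 td].
  have nt s (c : R) : 0 <= s <= t -> t * n < c -> `|s *: u| < c.
    move=> /andP[s0 st]; apply: le_lt_trans; rewrite normrZ ger0_norm//.
    by rewrite ler_pM// /n lerDl.
  have [s hs|s /andP[s0 st] fE] := @line_MVT R V f x u t t0.
    by apply: d1P; apply: nt hs td1.
  have := d2P (t *: u); rewrite (nt t d2) ?lexx ?(ltW t0)// => /(_ isT).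
  by rewrite -subr_le0 fE pmulr_rle0// leNgt pos// s0 (lt_trans st).
have pos0 u : differentiable ('D_u f) x -> 0 < 'D_u f x -> False.
  move=> du u0; have e0 : 0 < 'D_u f x / 2 by rewrite divr_gt0.
  have cu := differentiable_continuous du.
  have [d d0 dP] : exists2 d : R, 0 < d &
     forall h : V, `|h| < d -> 0 < 'D_u f (x + h).
    apply: (@nbhs_small_segment x (fun y => 0 < 'D_u f y)).
    exact: cvgr_gt cu 0 u0.
  pose n := `|u| + 1.
  have n0 : 0 < n by rewrite ltr_wpDl.
  apply: (nogrow u (d / n)); first exact: divr_gt0.
  move=> s /andP[s0 sd]; apply: dP; rewrite normrZ gtr0_norm//.
  by rewrite (le_lt_trans _ (_ : s * n < _)) -?ltr_pdivlMr// ler_pM2l// lerDl.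
have Nv y : differentiable f y -> 'D_(- v) f y = - 'D_v f y.
  by move=> dy; rewrite -scaleN1r derive_scale// scaleN1r.
have D0 : 'D_v f x = 0.
  apply/eqP; rewrite eq_le; apply/andP; split; rewrite leNgt; apply/negP.
    exact: pos0.
  rewrite -oppr_gt0 -Nv; last exact: nbhs_singleton df.
  apply: pos0; apply: near_eq_differentiable (differentiableN ddf).
  by apply: filterS df => y /Nv ->.
split=> //; rewrite leNgt; apply/negP => c0.
set c := 'D_v ('D_v f) x in c0.
have n0 : 0 < `|v| + 1 by rewrite ltr_wpDl.
have e0 : 0 < c / (2 * (`|v| + 1)) by rewrite divr_gt0// mulr_gt0.
have [d d0 dP] := differentiable_expansion e0 ddf.
apply: (nogrow v (d / (`|v| + 1))); first exact: divr_gt0.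
move=> s /andP[s0 sd].
have lt_s : `|s *: v| <= s * (`|v| + 1) by rewrite normrZ gtr0_norm// ler_pM2l// lerDl.
have := dP (s *: v); rewrite (le_lt_trans lt_s) -?ltr_pdivlMr// => /(_ isT).
rewrite D0 subr0 derive_scale// -/c => H.
have := le_trans H (ler_wpM2l (ltW e0) lt_s).
have -> : c / (2 * (`|v| + 1)) * (s * (`|v| + 1)) = s * c / 2 by field; rewrite gt_eqF.
rewrite ler_norml => /andP[+ _]; rewrite /GRing.scale /= => H2.
have : 0 < s * c by rewrite mulr_gt0.
by move: H2; set F := derive _ _ _; lra.
Qed.

End SecondDerivatives.

(** * Smooth functions on an open set *)

Section DerivativeRules.
Variables (R : realType) (V : normedModType R).
Implicit Types (f g : V -> R) (x v : V).

Lemma derive_add (W : normedModType R) (f g : V -> W) x v :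
  differentiable f x -> differentiable g x ->
  'D_v (fun y => f y + g y) x = 'D_v f x + 'D_v g x.
Proof. by move=> df dg; rewrite -deriveD//; apply: diff_derivable. Qed.

Lemma derive_mul f g x v : differentiable f x -> differentiable g x ->
  'D_v (fun y => f y * g y) x = 'D_v f x * g x + f x * 'D_v g x.
Proof.
move=> df dg; rewrite (@deriveM _ _ f g)//; try exact: diff_derivable.
by rewrite addrC mulrC.
Qed.

Lemma derive_bigsum (W : normedModType R) (I : finType) (F : I -> V -> W) x v :
  (forall i, differentiable (F i) x) ->
  'D_v (fun y => \sum_i F i y) x = \sum_i 'D_v (F i) x.
Proof.
move=> dF; suff [] : differentiable (fun y => \sum_i F i y) x /\
  'D_v (fun y => \sum_i F i y) x = \sum_i 'D_v (F i) x by [].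
elim: (index_enum I) => [|i r [dr er]].
  by under eq_fun do rewrite big_nil; rewrite big_nil derive_cst; split.
under eq_fun do rewrite big_cons; rewrite big_cons; split.
  exact: (differentiableD (dF i) dr).
by rewrite derive_add // er.
Qed.

Lemma differentiable_bigsum (W : normedModType R) (I : finType)
    (F : I -> V -> W) x :
  (forall i, differentiable (F i) x) -> differentiable (fun y => \sum_i F i y) x.
Proof.
move=> dF; elim: (index_enum I) => [|i r dr].
  by under eq_fun do rewrite big_nil.
under eq_fun do rewrite big_cons; exact: (differentiableD (dF i) dr).
Qed.

Lemma differentiable_ln f x : 0 < f x -> differentiable f x ->
  differentiable (fun y => ln (f y)) x.
Proof.
move=> f0 df; apply: (@differentiable_comp _ _ _ _ f (@ln R)) => //.
by apply/derivable1_diffP; have [] := is_derive1_ln f0.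
Qed.

Lemma derive_ln f x v : 0 < f x -> differentiable f x ->
  'D_v (fun y => ln (f y)) x = (f x)^-1 * 'D_v f x.
Proof.
move=> f0 df.
have dl : differentiable (@ln R) (f x).
  by apply/derivable1_diffP; have [] := is_derive1_ln f0.
have dlE (a : R) : 'd (@ln R) (f x) a = (f x)^-1 * a.
  have [_ <-] := is_derive1_ln f0.
  by rewrite -[a in LHS]mulr1 -[a * 1]/(a *: (1 : R)) linearZ -deriveE// mulrC.
rewrite deriveE; last exact: differentiable_ln.
by rewrite (@diff_comp _ _ _ _ f (@ln R) x df dl) /= dlE deriveE.
Qed.

Lemma derive_const (W : normedModType R) (c : W) x v : 'D_v (fun=> c) x = 0.
Proof. exact: derive_cst. Qed.

End DerivativeRules.

Section Smooth.
Variables (R : realType) (V : normedModType R) (U : set V) (oU : open U).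

(** Smoothness is stratified by the number of available derivatives, so that
    the closure properties follow by induction on this number. *)
Fixpoint kdiff (W : normedModType R) (k : nat) (f : V -> W) : Prop :=
  if k is k'.+1 then
    (forall x, U x -> differentiable f x) /\ forall v, kdiff k' ('D_v f)
  else True.

Definition smooth (W : normedModType R) (f : V -> W) := forall k, kdiff k f.

Section General.
Variables (W : normedModType R).
Implicit Types (f g : V -> W).

Lemma near_open x : U x -> \forall y \near x, U y.
Proof. by move=> Ux; exact: open_nbhs_nbhs. Qed.

Lemma derive_ext f g x v : (forall y, U y -> f y = g y) -> U x ->
  'D_v f x = 'D_v g x.
Proof.
move=> fg Ux; apply: near_eq_derive; apply: filterS (near_open Ux) => y.
exact: fg.
Qed.

Lemma kdiff_ext k f g : (forall x, U x -> f x = g x) -> kdiff k f -> kdiff k g.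
Proof.
elim: k f g => //= k IH f g fg [df kf]; split=> [x Ux|v].
  apply: near_eq_differentiable (df x Ux).
  by apply: filterS (near_open Ux) => y; exact: fg.
by apply: IH (kf v) => x Ux; exact: derive_ext.
Qed.

Lemma kdiff_weaken k f : kdiff k.+1 f -> kdiff k f.
Proof.
by elim: k f => //= k IH f [df kf]; split=> // v; apply: IH; apply: kf.
Qed.

Lemma smooth_differentiable f x : smooth f -> U x -> differentiable f x.
Proof. by move=> /(_ 1%N) [df _]; exact: df. Qed.

Lemma smooth_derive f v : smooth f -> smooth ('D_v f).
Proof. by move=> sf k; have [_] := sf k.+1; apply. Qed.

Lemma smooth_ext f g : (forall x, U x -> f x = g x) -> smooth f -> smooth g.
Proof. by move=> fg sf k; exact: kdiff_ext (sf k). Qed.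

Lemma kdiff_cst k (c : W) : kdiff k (fun=> c).
Proof.
elim: k c => //= k IH c; split=> [x _|v]; first exact: differentiable_cst.
by apply: kdiff_ext (IH 0) => x _; rewrite derive_const.
Qed.

Lemma kdiffD k f g : kdiff k f -> kdiff k g -> kdiff k (fun y => f y + g y).
Proof.
elim: k f g => //= k IH f g [df kf] [dg kg]; split=> [x Ux|v].
  by apply: differentiableD; [exact: df|exact: dg].
by apply: kdiff_ext (IH _ _ (kf v) (kg v)) => x Ux; rewrite derive_add; auto.
Qed.

Lemma kdiff_sum k (I : finType) (P : pred I) (F : I -> V -> W) :
  (forall i, kdiff k (F i)) -> kdiff k (fun y => \sum_(i | P i) F i y).
Proof.
move=> kF; elim: (index_enum I) => [|i r IH].
  by apply: kdiff_ext (kdiff_cst k 0) => x _; rewrite big_nil.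
case: (boolP (P i)) => Pi; last by apply: kdiff_ext IH => x _; rewrite big_cons (negbTE Pi).
by apply: kdiff_ext (kdiffD (kF i) IH) => x _; rewrite big_cons Pi.
Qed.

Lemma smooth_cst (c : W) : smooth (fun=> c).
Proof. by move=> k; exact: kdiff_cst. Qed.

Lemma smoothD f g : smooth f -> smooth g -> smooth (fun y => f y + g y).
Proof. by move=> sf sg k; exact: kdiffD. Qed.

Lemma smooth_sum (I : finType) (P : pred I) (F : I -> V -> W) :
  (forall i, smooth (F i)) -> smooth (fun y => \sum_(i | P i) F i y).
Proof. by move=> sF k; apply: kdiff_sum => i; exact: sF. Qed.

End General.

Section Scalar.
Implicit Types (f g : V -> R).

Lemma kdiffM k f g : kdiff k f -> kdiff k g -> kdiff k (fun y => f y * g y).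
Proof.
elim: k f g => //= k IH f g kf kg; have [[df kf'] [dg kg']] := (kf, kg).
split=> [x Ux|v]; first by apply: differentiableM; [exact: df|exact: dg].
apply: (@kdiff_ext _ k (fun y => 'D_v f y * g y + f y * 'D_v g y)).
  by move=> x Ux; rewrite derive_mul; auto.
by apply: kdiffD; apply: IH => //; exact: kdiff_weaken.
Qed.

Lemma kdiff_prod k (I : Type) (r : seq I) (P : pred I) (F : I -> V -> R) :
  (forall i, kdiff k (F i)) -> kdiff k (fun y => \prod_(i <- r | P i) F i y).
Proof.
move=> kF; elim: r => [|i r IH].
  by apply: kdiff_ext (kdiff_cst k (1 : R)) => x _; rewrite big_nil.
case: (boolP (P i)) => Pi; last by apply: kdiff_ext IH => x _; rewrite big_cons (negbTE Pi).
by apply: kdiff_ext (kdiffM (kF i) IH) => x _; rewrite big_cons Pi.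
Qed.

Lemma kdiffV k f : (forall x, U x -> f x != 0) -> kdiff k f ->
  kdiff k (fun y => (f y)^-1).
Proof.
move=> f0; elim: k => //= k IH kf; have [df kf'] := kf.
split=> [x Ux|v]; first by apply: differentiableV; [exact: df|exact: f0].
have kfV := IH (kdiff_weaken kf).
apply: (@kdiff_ext _ k (fun y => -1 * ((f y)^-1 * (f y)^-1) * 'D_v f y)).
  move=> x Ux; rewrite deriveV ?f0//; last by apply: diff_derivable; auto.
  by rewrite mulN1r expr2 invfM.
apply: kdiffM => //; apply: kdiffM; last exact: kdiffM.
exact: kdiff_cst.
Qed.

Lemma smoothM f g : smooth f -> smooth g -> smooth (fun y => f y * g y).
Proof. by move=> sf sg k; exact: kdiffM. Qed.

Lemma smooth_prod (I : Type) (r : seq I) (P : pred I) (F : I -> V -> R) :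
  (forall i, smooth (F i)) -> smooth (fun y => \prod_(i <- r | P i) F i y).
Proof. by move=> sF k; apply: kdiff_prod => i; exact: sF. Qed.

Lemma smoothV f : (forall x, U x -> f x != 0) -> smooth f ->
  smooth (fun y => (f y)^-1).
Proof. by move=> f0 sf k; exact: kdiffV. Qed.

Lemma smoothN f : smooth f -> smooth (fun y => - f y).
Proof.
move=> sf; apply: smooth_ext (smoothM (smooth_cst (-1 : R)) sf) => x _.
by rewrite mulN1r.
Qed.

Lemma smooth_ln f : (forall x, U x -> 0 < f x) -> smooth f ->
  smooth (fun y => ln (f y)).
Proof.
move=> f0 sf [|k] //=; split=> [x Ux|v].
  by apply: differentiable_ln; [exact: f0|exact: smooth_differentiable].
apply: (@kdiff_ext _ k (fun y => (f y)^-1 * 'D_v f y)).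
  by move=> x Ux; rewrite derive_ln; auto; exact: smooth_differentiable.
apply: smoothM; last exact: smooth_derive.
by apply: smoothV => // x /f0; exact: lt0r_neq0.
Qed.

Lemma smooth_det n (A : 'I_n -> 'I_n -> V -> R) :
  (forall i j, smooth (A i j)) ->
  smooth (fun y => \det (\matrix_(i, j) A i j y)).
Proof.
move=> sA.
apply: (@smooth_ext _ (fun y => \sum_(s : {perm 'I_n}) (-1) ^+ s * \prod_i A i (s i) y)).
  move=> x _; rewrite /determinant; apply: eq_bigr => s _; congr (_ * _).
  by apply: eq_bigr => i _; rewrite mxE.
apply: smooth_sum => s; apply: smoothM; first exact: smooth_cst.
by apply: smooth_prod => i; exact: sA.
Qed.

End Scalar.

End Smooth.

(** * Vector- and matrix-valued smooth functions *)

Section Coordinates.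
Variables (R : realType) (V : normedModType R).
Implicit Types (x v : V).

Lemma derive_coord a b (f : V -> 'M[R]_(a, b)) x v i j :
  differentiable f x -> 'D_v (fun y => f y i j) x = ('D_v f x) i j.
Proof. by move=> df; rewrite derive_mx ?mxE//; exact: diff_derivable. Qed.

Lemma differentiable_entry a b (f : V -> 'M[R]_(a, b)) x i j :
  differentiable f x -> differentiable (fun y => f y i j) x.
Proof.
move=> df; apply: (@differentiable_comp _ _ _ _ f (fun M : 'M[R]_(a, b) => M i j)) => //.
exact: differentiable_coord.
Qed.

Lemma derive_dotv n (f g : V -> 'rV[R]_n) x v :
  differentiable f x -> differentiable g x ->
  'D_v (fun y => dotv (f y) (g y)) x =
    dotv ('D_v f x) (g x) + dotv (f x) ('D_v g x).
Proof.
move=> df dg; under eq_fun do rewrite dotvE.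
rewrite derive_bigsum; last first.
  by move=> i; apply: differentiableM; exact: differentiable_entry.
rewrite !dotvE -big_split; apply: eq_bigr => i _ /=.
by rewrite derive_mul ?derive_coord//; exact: differentiable_entry.
Qed.

Lemma derive_scale_cst (W : normedModType R) (f : V -> R) (w : W) x v :
  differentiable f x -> 'D_v (fun y => f y *: w) x = 'D_v f x *: w.
Proof. by move=> df; rewrite !deriveE// ?diffZl//; exact: differentiableZl. Qed.

Variables (U : set V) (oU : open U).

Lemma smooth_entry a b (f : V -> 'M[R]_(a, b)) i j :
  smooth U f -> smooth U (fun y => f y i j).
Proof.
move=> sf k; elim: k f sf => //= k IH f sf; split=> [x Ux|v].
  exact: differentiable_entry (smooth_differentiable sf Ux).
apply: (kdiff_ext oU _ (IH _ (smooth_derive v sf))) => x Ux.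
by rewrite derive_coord//; exact: smooth_differentiable sf Ux.
Qed.

Lemma smooth_scale_cst (W : normedModType R) (f : V -> R) (w : W) :
  smooth U f -> smooth U (fun y => f y *: w).
Proof.
move=> sf k; elim: k f sf => //= k IH f sf; split=> [x Ux|v].
  exact: differentiableZl (smooth_differentiable sf Ux).
apply: (kdiff_ext oU _ (IH _ (smooth_derive v sf))) => x Ux.
have df := smooth_differentiable sf Ux.
by rewrite !deriveE// ?diffZl//; exact: differentiableZl.
Qed.

Lemma smooth_row n (f : V -> 'rV[R]_n) :
  (forall j, smooth U (fun y => f y 0 j)) -> smooth U f.
Proof.
move=> sf; apply: (@smooth_ext _ _ _ oU _ (fun y => \sum_j f y 0 j *: delta_mx 0 j)).
  by move=> x _; rewrite -row_sum_delta.
by apply: smooth_sum => // j; exact: smooth_scale_cst.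
Qed.

Lemma smooth_dotv n (f g : V -> 'rV[R]_n) :
  smooth U f -> smooth U g -> smooth U (fun y => dotv (f y) (g y)).
Proof.
move=> sf sg; under eq_fun do rewrite dotvE.
by apply: smooth_sum => // i; apply: smoothM => //; exact: smooth_entry.
Qed.

Lemma smooth_mulmx a b c (A : V -> 'M[R]_(a, b)) (B : V -> 'M[R]_(b, c)) :
  (forall i j, smooth U (fun y => A y i j)) ->
  (forall i j, smooth U (fun y => B y i j)) ->
  forall i j, smooth U (fun y => (A y *m B y) i j).
Proof.
move=> sA sB i j.
apply: (@smooth_ext _ _ _ oU _ (fun y => \sum_l A y i l * B y l j)).
  by move=> x _; rewrite mxE.
by apply: smooth_sum => // l; exact: smoothM.
Qed.

Lemma smooth_trace n (A : V -> 'M[R]_n) :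
  (forall i j, smooth U (fun y => A y i j)) -> smooth U (fun y => \tr (A y)).
Proof. by move=> sA; apply: smooth_sum. Qed.

Lemma smooth_determinant n (A : V -> 'M[R]_n) :
  (forall i j, smooth U (fun y => A y i j)) -> smooth U (fun y => \det (A y)).
Proof.
move=> sA; apply: smooth_ext (smooth_det oU sA) => // x _.
by congr (\det _); apply/matrixP => i j; rewrite mxE.
Qed.

Lemma smooth_cofactor n (A : V -> 'M[R]_n) :
  (forall i j, smooth U (fun y => A y i j)) ->
  forall i j, smooth U (fun y => cofactor (A y) i j).
Proof.
move=> sA i j; apply: smoothM => //; first exact: smooth_cst.
apply: smooth_determinant => k l.
rewrite (_ : (fun y => _) = fun y => A y (lift i k) (lift j l)) //.
by apply/funext => y; rewrite !mxE.
Qed.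

Lemma smooth_invmx n (A : V -> 'M[R]_n) :
  (forall i j, smooth U (fun y => A y i j)) ->
  (forall x, U x -> A x \in unitmx) ->
  forall i j, smooth U (fun y => invmx (A y) i j).
Proof.
move=> sA uA i j.
apply: (@smooth_ext _ _ _ oU _ (fun y => (\det (A y))^-1 * cofactor (A y) j i)).
  by move=> x Ux; rewrite /invmx uA// !mxE.
apply: smoothM => //; last exact: smooth_cofactor.
apply: smoothV => //; last exact: smooth_determinant.
by move=> x /uA; rewrite unitmxE unitfE.
Qed.

End Coordinates.

Section Jacobi.
Variables (R : realType) (V : normedModType R).

Lemma derive_bigprod (x v : V) (I : eqType) (r : seq I) (F : I -> V -> R) :
  uniq r -> (forall i, differentiable (F i) x) ->
  differentiable (fun y => \prod_(i <- r) F i y) x /\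
  'D_v (fun y => \prod_(i <- r) F i y) x =
    \sum_(i <- r) \prod_(j <- r) (if j == i then 'D_v (F i) x else F j x).
Proof.
move=> + dF; elim: r => [_|i r IH /= /andP[ir ur]].
  by under eq_fun do rewrite big_nil; rewrite big_nil derive_const.
have [dr er] := IH ur.
under eq_fun do rewrite big_cons; split; first exact: differentiableM.
rewrite derive_mul// er big_cons big_cons eqxx; congr (_ * _ + _).
  apply: eq_big_seq => j jr.
  by case: eqP => // ji; rewrite -ji jr in ir.
rewrite mulr_sumr; apply: eq_big_seq => j jr.
by rewrite big_cons; case: eqP => // ij; rewrite ij jr in ir.
Qed.

(** Differentiating one factor of each term of the Leibniz formula amounts to
    replacing one row of the matrix by its derivative; that determinant is
    then expanded along this row. *)
Lemma derive_det n (A : V -> 'M[R]_n) (x v : V) :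
  (forall i j, differentiable (fun y => A y i j) x) ->
  'D_v (fun y => \det (A y)) x =
    \sum_i \sum_j 'D_v (fun y => A y i j) x * cofactor (A x) i j.
Proof.
move=> dA.
have dP (s : {perm 'I_n}) :=
  derive_bigprod v (index_enum_uniq 'I_n) (fun i => dA i (s i)).
rewrite /determinant derive_bigsum; last first.
  by move=> s; apply: differentiableM; [exact: differentiable_cst|exact: (dP s).1].
pose B i := \matrix_(k, l) if k == i then 'D_v (fun y => A y i l) x else A x k l.
transitivity (\sum_i \det (B i)).
  rewrite exchange_big; apply: eq_bigr => s _ /=.
  rewrite derive_mul; [|exact: differentiable_cst|exact: (dP s).1].
  rewrite derive_const mul0r add0r (dP s).2 mulr_sumr; apply: eq_bigr => i _.
  by congr (_ * _); apply: eq_bigr => k _; rewrite mxE; case: eqP => // ->.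
apply: eq_bigr => i _; rewrite (expand_det_row _ i); apply: eq_bigr => j _.
rewrite mxE eqxx; congr (_ * (_ * \det _)); apply/matrixP => k l.
by rewrite !mxE eq_sym (negbTE (neq_lift _ _)).
Qed.

End Jacobi.

Section Composition.
Variables (R : realType) (m : nat).

Lemma derive_row_expansion (W : normedModType R) (f : 'rV[R]_m -> W)
    (x v : 'rV[R]_m) : differentiable f x ->
  'D_v f x = \sum_l v 0 l *: 'D_(delta_mx 0 l) f x.
Proof.
move=> df; rewrite [in LHS](row_sum_delta v) deriveE// linear_sum.
by apply: eq_bigr => l _; rewrite linearZ deriveE.
Qed.

Variable V : normedModType R.

Lemma derive_comp (W : normedModType R) (f : 'rV[R]_m -> W)
    (phi : V -> 'rV[R]_m) x v :
  differentiable phi x -> differentiable f (phi x) ->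
  'D_v (f \o phi) x = 'D_('D_v phi x) f (phi x).
Proof.
move=> dp df; rewrite !deriveE//; last exact: differentiable_comp.
by rewrite diff_comp.
Qed.

Variables (U : set 'rV[R]_m) (U' : set V) (oU' : open U').
Variable phi : V -> 'rV[R]_m.
Hypotheses (sphi : smooth U' phi) (phiU : forall y, U' y -> U (phi y)).

(** The chain rule writes a derivative of [f \o phi] as a sum of products of
    derivatives of [phi] with functions of the form [f' \o phi], where [f'] is
    a partial derivative of [f]; the induction on the order thus has to be done
    for all [f] at once. *)
Lemma smooth_comp (f : 'rV[R]_m -> R) : smooth U f -> smooth U' (f \o phi).
Proof.
move=> sf k; elim: k f sf => //= k IH f sf; split=> [y Uy|v].
  apply: differentiable_comp; first exact: smooth_differentiable sphi Uy.
  exact: smooth_differentiable sf (phiU Uy).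
apply: (@kdiff_ext _ _ _ oU' _ k (fun y => \sum_l ('D_v phi y) 0 l *
    ('D_(delta_mx 0 l) f \o phi) y)).
  move=> y Uy; rewrite derive_comp; last 2 first.
  - exact: smooth_differentiable sphi Uy.
  - exact: smooth_differentiable sf (phiU Uy).
  rewrite [RHS]derive_row_expansion //.
  exact: smooth_differentiable sf (phiU Uy).
apply: kdiff_sum => // l; apply: kdiffM => //.
  by apply: smooth_entry => //; exact: smooth_derive.
by apply: IH; exact: smooth_derive.
Qed.

Lemma smooth_comp_row n (f : 'rV[R]_m -> 'rV[R]_n) : open U -> smooth U f ->
  smooth U' (f \o phi).
Proof.
move=> oU sf; apply: smooth_row => // j.
exact: (smooth_comp (smooth_entry oU 0 j sf)).
Qed.

End Composition.

Lemma smooth_onW (R : realType) m n (U : set 'rV[R]_m) (f : 'rV[R]_m -> 'rV[R]_n) :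
  smooth_on U f -> smooth U f.
Proof.
move=> sf k; elim: k f sf => //= k IH f sf; split=> [x|v]; first exact: (sf [::]).
apply: IH => vs x Ux; have := sf (rcons vs v) x Ux.
by rewrite foldr_rcons.
Qed.

Lemma row_jacobian (R : realType) m n (f : 'rV[R]_m -> 'rV[R]_n) x i :
  differentiable f x -> row i ('J f x) = 'D_(delta_mx 0 i) f x.
Proof. by move=> df; rewrite deriveEjacobian// rowE. Qed.

(** * Second-order derivation rules *)

Section SecondOrderRules.
Variables (R : realType) (m : nat).
Variables (U : set 'rV[R]_m) (oU : open U).
Implicit Types (v w x : 'rV[R]_m).

Lemma derive_commute_row n (f : 'rV[R]_m -> 'rV[R]_n) v w x :
  smooth U f -> U x -> 'D_v ('D_w f) x = 'D_w ('D_v f) x.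
Proof.
move=> sf Ux; apply/rowP => j.
have sfj := smooth_entry oU 0 j sf.
have E u y : U y -> 'D_u (fun z => f z 0 j) y = ('D_u f y) 0 j.
  by move=> Uy; rewrite derive_coord//; exact: smooth_differentiable sf Uy.
have E2 u u' : ('D_u ('D_u' f) x) 0 j = 'D_u ('D_u' (fun z => f z 0 j)) x.
  rewrite -derive_coord; last exact: smooth_differentiable (smooth_derive u' sf) Ux.
  by apply: (derive_ext oU) => // y Uy; rewrite E.
apply: etrans (E2 v w) (etrans _ (esym (E2 w v))).
apply: (@derive_commute _ _ (fun z => f z 0 j)).
- by apply: filterS (near_open oU Ux) => y; exact: smooth_differentiable.
- exact: smooth_differentiable (smooth_derive _ sfj) Ux.
- exact: smooth_differentiable (smooth_derive _ sfj) Ux.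
Qed.

Lemma derive2_mul (f g : 'rV[R]_m -> R) v x : smooth U f -> smooth U g -> U x ->
  'D_v ('D_v (fun y => f y * g y)) x =
  'D_v ('D_v f) x * g x + 2 * ('D_v f x * 'D_v g x) + f x * 'D_v ('D_v g) x.
Proof.
move=> sf sg Ux.
have df h y : smooth U h -> U y -> differentiable h y by exact: smooth_differentiable.
rewrite (derive_ext oU (g := fun y => 'D_v f y * g y + f y * 'D_v g y)) //; last first.
  by move=> y Uy; rewrite derive_mul//; apply: df.
have sdf := smooth_derive v sf; have sdg := smooth_derive v sg.
rewrite derive_add; [|by apply: differentiableM; apply: df..].
have E1 := derive_mul v (df _ _ _ sdf Ux) (df _ _ _ sg Ux).
have E2 := derive_mul v (df _ _ _ sf Ux) (df _ _ _ sdg Ux).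
apply: etrans (congr2 +%R E1 E2) _.
by move: ('D_v ('D_v f) x) ('D_v f x) ('D_v ('D_v g) x) ('D_v g x); move=> *; ring.
Qed.

Lemma derive2_dotv n (f g : 'rV[R]_m -> 'rV[R]_n) v x :
  smooth U f -> smooth U g -> U x ->
  'D_v ('D_v (fun y => dotv (f y) (g y))) x =
  dotv ('D_v ('D_v f) x) (g x) + 2 * dotv ('D_v f x) ('D_v g x)
    + dotv (f x) ('D_v ('D_v g) x).
Proof.
move=> sf sg Ux.
have df (h : 'rV[R]_m -> 'rV[R]_n) y : smooth U h -> U y -> differentiable h y.
  by exact: smooth_differentiable.
rewrite (derive_ext oU
  (g := fun y => dotv ('D_v f y) (g y) + dotv (f y) ('D_v g y))) //; last first.
  by move=> y Uy; rewrite derive_dotv//; apply: df.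
have sdf := smooth_derive v sf; have sdg := smooth_derive v sg.
rewrite derive_add; try by apply: (smooth_differentiable (U := U)) => //; exact: smooth_dotv.
have E1 := derive_dotv v (df _ _ sdf Ux) (df _ _ sg Ux).
have E2 := derive_dotv v (df _ _ sf Ux) (df _ _ sdg Ux).
apply: etrans (congr2 +%R E1 E2) _.
move: (dotv ('D_v ('D_v f) x) (g x)) (dotv ('D_v f x) ('D_v g x)) (dotv (f x) _).
by move=> *; ring.
Qed.

End SecondOrderRules.

(** The directional derivative as a sealed operator, so that distinct iterated
    derivatives are never compared through the limits that define them. *)
HB.lock Definition dird (R : realType) (V W : normedModType R) (v : V)
  (f : V -> W) : V -> W := 'D_v f.

Section SealedDerivative.
Variables (R : realType) (m : nat).
Variables (U : set 'rV[R]_m) (oU : open U).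
Implicit Types (v w x : 'rV[R]_m).

Let dif (W : normedModType R) (f : _ -> W) x (sf : smooth U f) (Ux : U x) :=
  smooth_differentiable sf Ux.

Lemma dirdE (W : normedModType R) v (f : _ -> W) x : dird v f x = 'D_v f x.
Proof. by rewrite unlock. Qed.

Lemma smooth_dird (W : normedModType R) (f : _ -> W) v :
  smooth U f -> smooth U (dird v f).
Proof. by rewrite unlock; exact: smooth_derive. Qed.

Lemma dird_ext (W : normedModType R) (f g : _ -> W) x v :
  (forall y, U y -> f y = g y) -> U x -> dird v f x = dird v g x.
Proof. by rewrite unlock; exact: derive_ext. Qed.

Lemma dird_const (W : normedModType R) (f : _ -> W) c x v :
  (forall y, U y -> f y = c) -> U x -> dird v f x = 0.
Proof. by move=> /(@dird_ext _ f (fun=> c) x v) E /E ->; rewrite dirdE derive_const. Qed.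

Lemma dird_add (W : normedModType R) (f g : _ -> W) x v :
  smooth U f -> smooth U g -> U x ->
  dird v (fun y => f y + g y) x = dird v f x + dird v g x.
Proof.
by move=> sf sg Ux; rewrite !dirdE; exact: derive_add (dif sf Ux) (dif sg Ux).
Qed.

Lemma dird_sum (W : normedModType R) (I : finType) (F : I -> _ -> W) x v :
  (forall i, smooth U (F i)) -> U x ->
  dird v (fun y => \sum_i F i y) x = \sum_i dird v (F i) x.
Proof.
move=> sF Ux; rewrite dirdE derive_bigsum => [|i]; last exact: dif (sF i) Ux.
by apply: eq_bigr => i _; rewrite dirdE.
Qed.

Lemma dird_mul (f g : _ -> R) x v : smooth U f -> smooth U g -> U x ->
  dird v (fun y => f y * g y) x = dird v f x * g x + f x * dird v g x.
Proof.
by move=> sf sg Ux; rewrite !dirdE derive_mul//; exact: smooth_differentiable.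
Qed.

Lemma dird_dotv n (f g : _ -> 'rV[R]_n) x v : smooth U f -> smooth U g -> U x ->
  dird v (fun y => dotv (f y) (g y)) x =
    dotv (dird v f x) (g x) + dotv (f x) (dird v g x).
Proof.
move=> sf sg Ux; rewrite !dirdE derive_dotv//; [exact: dif sf Ux|exact: dif sg Ux].
Qed.

Lemma dird2_mul (f g : _ -> R) x v : smooth U f -> smooth U g -> U x ->
  dird v (dird v (fun y => f y * g y)) x =
  dird v (dird v f) x * g x + 2 * (dird v f x * dird v g x)
    + f x * dird v (dird v g) x.
Proof. by rewrite unlock; exact: derive2_mul. Qed.

Lemma dird2_dotv n (f g : _ -> 'rV[R]_n) x v :
  smooth U f -> smooth U g -> U x ->
  dird v (dird v (fun y => dotv (f y) (g y))) x =
  dotv (dird v (dird v f) x) (g x) + 2 * dotv (dird v f x) (dird v g x)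
    + dotv (f x) (dird v (dird v g) x).
Proof. by rewrite unlock; exact: derive2_dotv. Qed.

Lemma dird_commute n (f : _ -> 'rV[R]_n) v w x :
  smooth U f -> U x -> dird v (dird w f) x = dird w (dird v f) x.
Proof. by rewrite unlock; exact: derive_commute_row. Qed.

Lemma dird_det n (A : _ -> 'M[R]_n) x v :
  (forall i j, smooth U (fun y => A y i j)) -> U x ->
  dird v (fun y => \det (A y)) x =
    \sum_i \sum_j dird v (fun y => A y i j) x * cofactor (A x) i j.
Proof.
move=> sA Ux; rewrite dirdE derive_det => [|i j]; last exact: dif (sA i j) Ux.
by apply: eq_bigr => i _; apply: eq_bigr => j _; rewrite dirdE.
Qed.

Lemma dird2_max (f : _ -> R) x v : smooth U f -> U x ->
  (forall y, U y -> f y <= f x) -> dird v (dird v f) x <= 0.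
Proof.
move=> sf Ux fmax; rewrite unlock.
have [|||_ le0] := @second_derivative_at_max _ _ f x v.
- by apply: filterS (near_open oU Ux) => y; exact: smooth_differentiable.
- exact: dif (smooth_derive v sf) Ux.
- exact: filterS fmax (near_open oU Ux).
- exact: le0.
Qed.

End SealedDerivative.

(** * A maximum of the mean curvature when the determinant is constant *)

(** Here [a k i] stands for the [i]-th diagonal entry of the second derivative
    of the shape operator in the direction [k]. The differences [a k i - a i k]
    depend on the principal curvatures only: this is Simons' identity. The two
    families of inequalities, the first one summed over [k], the second one after
    division by [lam k], therefore leave [\sum (lam i - lam k) ^+ 2 <= 0]. *)
Lemma curvatures_equal (R : realType) m (lam : 'I_m -> R) (a F T : 'I_m -> 'I_m -> R) :
  (forall i, 0 < lam i) -> (forall k i, F k i = F i k) ->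
  (forall k i, a k i = F k i - 2 * (lam k * T k i) - lam i * lam k ^+ 2
     - lam i * (2 * T i k + 2 * (lam i ^+ 2 *+ (k == i)))) ->
  (forall k, 0 <= \sum_i a k i / lam i) -> (forall k, \sum_i a k i <= 0) ->
  forall i j, lam i = lam j.
Proof.
move=> lam0 Fs aE ge0 le0.
have antisym k i : (a k i - a i k) / lam k = lam i * (lam i - lam k).
  rewrite !aE (Fs i k) [i == k]eq_sym; case: (eqVneq k i) => [->|_].
    by rewrite !subrr mulr0 mul0r.
  by rewrite !mulr0n; field; rewrite gt_eqF.
have S0 : \sum_k \sum_i lam i * (lam i - lam k) <= 0.
  have -> : \sum_k \sum_i lam i * (lam i - lam k) =
      \sum_k (\sum_i a k i) / lam k - \sum_k \sum_i a k i / lam i.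
    rewrite [X in _ - X]exchange_big -sumrB; apply: eq_bigr => k _ /=.
    rewrite mulr_suml -sumrB; apply: eq_bigr => i _.
    by rewrite -antisym mulrBl.
  rewrite subr_le0 (le_trans (_ : _ <= 0)) ?sumr_ge0//.
  by apply: sumr_le0 => k _; rewrite pmulr_lle0 ?invr_gt0.
have S2 : \sum_k \sum_i (lam i - lam k) ^+ 2 = 2 * \sum_k \sum_i lam i * (lam i - lam k).
  rewrite mulr_natl mulr2n [X in X + _]exchange_big -big_split; apply: eq_bigr => k _ /=.
  by rewrite -big_split; apply: eq_bigr => i _ /=; ring.
have z k i : (lam i - lam k) ^+ 2 = 0.
  have : \sum_k \sum_i (lam i - lam k) ^+ 2 == 0.
    rewrite eq_le S2 pmulr_rle0// S0 -S2 sumr_ge0// => k' _.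
    by apply: sumr_ge0 => i' _; exact: sqr_ge0.
  rewrite psumr_eq0 => [/allP/(_ k (mem_index_enum k))|k' _]; last first.
    by apply: sumr_ge0 => i' _; exact: sqr_ge0.
  rewrite implyTb psumr_eq0 => [/allP/(_ i (mem_index_enum i))|i' _]; last exact: sqr_ge0.
  by rewrite implyTb => /eqP.
move=> i j; apply/eqP; rewrite -subr_eq0 -sqrf_eq0; apply/eqP; exact: z.
Qed.

(** [Y] is an immersion with unit normal [nu] and shape operator [A]; [g] and [h]
    are its first and second fundamental forms. At [x0] the coordinates are
    normal: [g] is the identity, [h] is diagonal and, by [Y20], the Christoffel
    symbols of [g] vanish. *)
Section ConstantCurvature.
Variables (R : realType) (m : nat).
Variables (U : set 'rV[R]_m) (oU : open U) (x0 : 'rV[R]_m) (Ux0 : U x0).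
Variables (Y nu : 'rV[R]_m -> 'rV[R]_m.+1) (A : 'rV[R]_m -> 'M[R]_m).
Hypotheses (sY : smooth U Y) (snu : smooth U nu).
Hypothesis sA : forall i j, smooth U (fun x => A x i j).

Local Notation "'d_' i" := (dird (delta_mx 0 i : 'rV[R]_m))
  (at level 8, i at level 2, format "'d_' i").
Local Notation Y_ i := (d_ i Y).
Let g (i j : 'I_m) x := dotv (Y_ i x) (Y_ j x).
Let h (i j : 'I_m) x := - dotv (d_ i nu x) (Y_ j x).

Hypothesis nu1 : forall x, U x -> dotv (nu x) (nu x) = 1.
Hypothesis nuY : forall x i, U x -> dotv (Y_ i x) (nu x) = 0.
Hypothesis Agh : forall x i j, U x -> \sum_l A x i l * g l j x = h i j x.

Variables (K : R) (lam : 'I_m -> R).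
Hypothesis lam0 : forall i, 0 < lam i.
Hypothesis detA : forall x, U x -> \det (A x) = K.
Hypothesis trA : forall x, U x -> \tr (A x) <= \tr (A x0).
Hypothesis g0 : forall i j, g i j x0 = (i == j)%:R.
Hypothesis h0 : forall i j, h i j x0 = lam i *+ (i == j).
Hypothesis Y20 : forall i j k, dotv (d_ i (Y_ j) x0) (Y_ k x0) = 0.

Let sD (W : normedModType R) (f : _ -> W) i (sf : smooth U f) :
  smooth U (d_ i f) := smooth_dird (delta_mx 0 i) sf.

Lemma second_formE i j x : U x -> h i j x = dotv (nu x) (d_ i (Y_ j) x).
Proof.
move=> Ux; rewrite /h.
have := dird_const oU (delta_mx 0 i) (fun y Uy => nuY j Uy) Ux.
rewrite (dird_dotv _ (sD j sY) snu Ux) [X in _ + X = _]dotvC [X in X + _ = _]dotvC.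
by move=> /eqP; rewrite addr_eq0 => /eqP ->.
Qed.

Lemma second_form_sym i j x : U x -> h i j x = h j i x.
Proof. by move=> Ux; rewrite !second_formE// (dird_commute oU _ _ sY Ux). Qed.

(** The frame together with the normal forms a matrix with orthonormal rows;
    being square, it also has orthonormal columns. *)
Lemma frame_expansion (w : 'rV[R]_m.+1) :
  w = \sum_k dotv w (Y_ k x0) *: Y_ k x0 + dotv w (nu x0) *: nu x0.
Proof.
pose J : 'M[R]_(m, m.+1) := \matrix_k Y_ k x0.
pose B : 'M[R]_(m + 1, m.+1) := col_mx J (nu x0).
have JJ : J *m J^T = 1%:M.
  apply/matrixP => i j; rewrite mxE [RHS]mxE -g0 /g dotvE.
  by apply: eq_bigr => k _; rewrite !mxE.
have Jnu : J *m (nu x0)^T = 0.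
  apply/matrixP => i j; rewrite ord1 mxE [RHS]mxE.
  apply: etrans _ (nuY i Ux0); rewrite dotvE.
  by apply: eq_bigr => k _; rewrite !mxE.
have nunu : nu x0 *m (nu x0)^T = 1%:M.
  by apply/matrixP => i j; rewrite !ord1 -/(dotv _ _) nu1// mxE.
have nuJ : nu x0 *m J^T = 0 by apply: trmx_inj; rewrite trmx_mul trmxK Jnu trmx0.
have BB : B *m B^T = 1%:M.
  by rewrite tr_col_mx mul_col_row JJ Jnu nunu nuJ -scalar_mx_block.
have square p q (C : 'M[R]_(p, q)) :
    p = q -> C *m C^T = 1%:M -> C^T *m C = 1%:M.
  by move=> pq; case: _ / pq C => C; exact: mulmx1C.
have BB' := square _ _ B (addn1 m) BB.
rewrite -[LHS]mulmx1 -BB' mulmxA tr_col_mx mul_mx_row mul_row_col; congr (_ + _).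
  rewrite mulmx_sum_row; apply: eq_bigr => k _; rewrite rowK; congr (_ *: _).
  by rewrite mxE dotvE; apply: eq_bigr => l _; rewrite !mxE.
by apply/rowP => j; rewrite [LHS]mxE big_ord1 [RHS]mxE.
Qed.

Lemma derive_normal0 k : d_ k nu x0 = - (lam k *: Y_ k x0).
Proof.
have Dnn : dotv (d_ k nu x0) (nu x0) = 0.
  have := dird_const oU (delta_mx 0 k) nu1 Ux0.
  rewrite (dird_dotv _ snu snu Ux0) [X in _ + X = _]dotvC -mulr2n => /eqP.
  by rewrite mulrn_eq0 => /eqP.
have Dnl l : dotv (d_ k nu x0) (Y_ l x0) = - (lam k *+ (k == l)).
  by rewrite -h0 /h opprK.
rewrite [LHS]frame_expansion Dnn scale0r addr0 (bigD1 k)//= big1 ?addr0 => [|l lk].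
  by rewrite Dnl eqxx scaleNr.
by rewrite Dnl eq_sym (negbTE lk) oppr0 scale0r.
Qed.

Lemma derive_frame0 i j : d_ i (Y_ j) x0 = (lam i *+ (i == j)) *: nu x0.
Proof.
rewrite [LHS]frame_expansion big1 ?add0r => [|k _]; last by rewrite Y20 scale0r.
by rewrite -h0 second_formE// dotvC.
Qed.

Lemma derive2_normal0 k : dotv (d_ k (d_ k nu) x0) (nu x0) = - lam k ^+ 2.
Proof.
have D1 y : U y -> d_ k (fun y => dotv (nu y) (nu y)) y = 0.
  exact: dird_const nu1.
have := dird_const oU (delta_mx 0 k) D1 Ux0.
rewrite (dird2_dotv oU _ snu snu Ux0) derive_normal0 dotvNl dotvNr opprK dotvZl dotvZr.
rewrite -/(g k k x0) g0 eqxx [X in _ + X = _]dotvC.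
move: (dotv _ _) => p E; have : 2 * (p + lam k ^+ 2) = 0 by rewrite -E /=; ring.
by move=> /eqP; rewrite mulf_eq0 pnatr_eq0 /= addr_eq0 => /eqP.
Qed.

(* Neither [T] nor [F] can be computed from the principal curvatures; they
   cancel in [a k i - a i k]. *)
Let T k i := dotv (Y_ k x0) (d_ k (d_ i (Y_ i)) x0).
Let F k i := dotv (nu x0) (d_ k (d_ k (d_ i (Y_ i))) x0).
Let a k i := d_ k (d_ k (fun x => A x i i)) x0.

Lemma derive2_second_form0 k i : d_ k (d_ k (h i i)) x0 =
  F k i - 2 * (lam k * T k i) - lam i * lam k ^+ 2.
Proof.
transitivity (d_ k (d_ k (fun y => dotv (nu y) (d_ i (Y_ i) y))) x0).
  apply: (dird_ext oU) => // y Uy; apply: (dird_ext oU) => // z; exact: second_formE.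
rewrite (dird2_dotv oU _ snu (sD i (sD i sY)) Ux0) derive_frame0 eqxx mulr1n dotvZr.
rewrite derive2_normal0 derive_normal0 dotvNl dotvZl -/(T k i) -/(F k i).
by move: (F k i) (T k i) => F' T'; ring.
Qed.

Lemma derive_metric0 k i j : d_ k (g i j) x0 = 0.
Proof.
by rewrite (dird_dotv _ (sD i sY) (sD j sY) Ux0) Y20 dotvC Y20 addr0.
Qed.

Lemma derive2_metric0 k i : d_ k (d_ k (g i i)) x0 =
  2 * T i k + 2 * (lam i ^+ 2 *+ (k == i)).
Proof.
have sYi := sD i sY; have sYk := sD k sY.
have E : d_ k (d_ k (Y_ i)) x0 = d_ i (d_ k (Y_ k)) x0.
  rewrite -(dird_commute oU _ _ sYk Ux0); apply: (dird_ext oU) => // y Uy.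
  exact: (dird_commute oU).
rewrite (dird2_dotv oU _ sYi sYi Ux0) E derive_frame0 dotvZl dotvZr nu1// mulr1.
rewrite [X in X + _ + _]dotvC -/(T i k); move: (T i k) => T'.
by case: eqP => [->|_]; rewrite ?mulr1n ?mulr0n; ring.
Qed.

(** Both sides are the normal component of the fourth derivative of [Y], twice
    in the direction [i] and twice in the direction [k]. *)
Lemma fourth_derivative_sym k i : F k i = F i k.
Proof.
rewrite /F; congr (dotv _ _).
have sYi := sD i sY; have sYk := sD k sY.
(* the outer derivatives move inside, one transposition at a time *)
have c1 y : U y -> d_ k (d_ i (Y_ i)) y = d_ i (d_ i (Y_ k)) y.
  move=> Uy; rewrite (dird_commute oU _ _ sYi Uy).
  by apply: (dird_ext oU) => // z Uz; rewrite (dird_commute oU _ _ sY Uz).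
have c2 y : U y -> d_ k (d_ i (Y_ k)) y = d_ i (d_ k (Y_ k)) y.
  by move=> Uy; rewrite (dird_commute oU _ _ sYk Uy).
apply: etrans (dird_ext oU _ c1 Ux0) _.
apply: etrans (dird_commute oU _ _ (sD i sYk) Ux0) _.
have E := dird_ext oU _ c2 Ux0. exact: E.
Qed.

Lemma shape0 i j : A x0 i j = lam i *+ (i == j).
Proof.
rewrite -h0 -Agh// (bigD1 j)//= big1 ?addr0 => [|l lj].
  by rewrite g0 eqxx mulr1.
by rewrite g0 (negbTE lj) mulr0.
Qed.

Let sg i j : smooth U (g i j).
Proof. by apply: smooth_dotv => //; exact: sD. Qed.

Let sAg i l j : smooth U (fun x => A x i l * g l j x).
Proof. by apply: smoothM. Qed.

Lemma derive_shape0 k i j : d_ k (fun x => A x i j) x0 = d_ k (h i j) x0.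
Proof.
rewrite -(dird_ext oU _ (fun y Uy => Agh i j Uy) Ux0).
rewrite (dird_sum _ (fun l => sAg i l j) Ux0).
rewrite (bigD1 j)//= big1 ?addr0 => [|l lj].
  rewrite (dird_mul _ (sA i j) (sg j j) Ux0).
  by rewrite derive_metric0 g0 eqxx mulr0 addr0 mulr1.
rewrite (dird_mul _ (sA i l) (sg l j) Ux0).
by rewrite derive_metric0 g0 (negbTE lj) !mulr0 addr0.
Qed.

(** The second derivative of [A g = h], where the first derivative of [g]
    vanishes and [g] is the identity. *)
Lemma derive2_shape0 k i : a k i =
  F k i - 2 * (lam k * T k i) - lam i * lam k ^+ 2
     - lam i * (2 * T i k + 2 * (lam i ^+ 2 *+ (k == i))).
Proof.
apply/eqP; rewrite eq_sym subr_eq -derive2_second_form0 -derive2_metric0; apply/eqP.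
have -> : d_ k (d_ k (h i i)) x0 = d_ k (fun y => \sum_l d_ k (fun x => A x i l * g l i x) y) x0.
  apply: (dird_ext oU) => // y Uy; rewrite -(dird_sum _ (fun l => sAg i l i) Uy).
  by apply: (dird_ext oU) => // z Uz; rewrite Agh.
rewrite (dird_sum _ (fun l => sD k (sAg i l i)) Ux0).
rewrite (bigD1 i)//= big1 ?addr0 => [|l li].
  rewrite (dird2_mul oU _ (sA i i) (sg i i) Ux0) derive_metric0 g0 eqxx shape0 eqxx.
  by rewrite /a !mulr0 mulr1 addr0.
rewrite (dird2_mul oU _ (sA i l) (sg l i) Ux0) derive_metric0 g0 (negbTE li) shape0.
by rewrite eq_sym (negbTE li) !mulr0 mul0r !addr0.
Qed.

Lemma trace_derive2_shape0 k : \sum_i a k i <= 0.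
Proof.
have := dird2_max oU (delta_mx 0 k) (smooth_trace oU sA) Ux0 trA.
apply: le_trans; rewrite le_eqVlt; apply/orP; left; apply/eqP.
rewrite /a -(dird_sum _ (fun i => sD k (sA i i)) Ux0).
apply: (dird_ext oU) => // y Uy.
by rewrite -(dird_sum _ (fun i => sA i i) Uy).
Qed.

(** Jacobi's formula, differentiated once more with the help of
    [A *m \adj A = K%:M], identifies the sum with that of the squares
    [DA i j ^+ 2 / (lam i * lam j)], because the first derivative [DA] of the
    shape operator is symmetric. *)
Lemma weighted_trace_derive2_shape0 k : 0 <= \sum_i a k i / lam i.
Proof.
have scof := smooth_cofactor oU sA.
have A0 : A x0 = diag_mx (\row_i lam i).
  by apply/matrixP => i j; rewrite shape0 !mxE.
have K0 : 0 < K.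
  by rewrite -(detA Ux0) A0 det_diag prodr_gt0// => i _; rewrite mxE.
have adj i l x : U x -> \sum_j A x i j * cofactor (A x) l j = K *+ (i == l).
  move=> Ux; have := mul_mx_adj (A x); rewrite detA// => /matrixP/(_ i l).
  by rewrite [RHS]mxE => <-; rewrite mxE; apply: eq_bigr => j _; rewrite mxE.
have cof0 l i : cofactor (A x0) l i = K / lam i *+ (i == l).
  have := adj i l x0 Ux0; rewrite (bigD1 i)//= big1 ?addr0 => [|j ji]; last first.
    by rewrite shape0 eq_sym (negbTE ji) mul0r.
  rewrite shape0 eqxx mulr1n => E.
  have l0 := lt0r_neq0 (lam0 i); apply: (mulfI l0); rewrite E.
  by rewrite -mulrnAr mulrCA mulrnAr divff// mulr_natr.
pose DA i j := d_ k (fun x => A x i j) x0.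
have DAs i j : DA i j = DA j i.
  rewrite /DA !derive_shape0; apply: (dird_ext oU) => // y; exact: second_form_sym.
have sAcof i l j := smoothM oU (sA i j) (scof l j).
have Dcof l i : d_ k (fun x => cofactor (A x) l i) x0 = - (K * DA i l / (lam i * lam l)).
  have := dird_const oU (delta_mx 0 k) (adj i l) Ux0.
  rewrite (dird_sum _ (fun j => sAcof i l j) Ux0).
  under eq_bigr => j _ do rewrite (dird_mul _ (sA i j) (scof l j) Ux0) cof0 shape0.
  rewrite big_split /= (bigD1 l)//= big1 ?addr0 => [|j jl]; last first.
    by rewrite (negbTE jl) mulr0.
  rewrite eqxx mulr1n (bigD1 i)//= big1 ?addr0 => [|j ji]; last first.
    by rewrite eq_sym (negbTE ji) mul0r.
  rewrite eqxx mulr1n -/(DA i l) => /eqP; rewrite addrC addr_eq0 => /eqP E.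
  have l1 := lt0r_neq0 (lam0 i); have l2 := lt0r_neq0 (lam0 l).
  apply: (mulfI l1); rewrite E; move: (DA i l) => D; field; exact/andP.
have E0 y : U y -> \sum_i \sum_j d_ k (fun x => A x i j) y * cofactor (A y) i j = 0.
  move=> Uy; rewrite -(dird_det _ sA Uy); exact: dird_const detA Uy.
have sAc i j := smoothM oU (sD k (sA i j)) (scof i j).
have E1 : \sum_i \sum_j (d_ k (d_ k (fun x => A x i j)) x0 * (K / lam j *+ (j == i))
    - DA i j * (K * DA j i / (lam j * lam i))) = 0.
  apply: etrans _ (dird_const oU (delta_mx 0 k) E0 Ux0).
  rewrite (dird_sum _ (fun i => smooth_sum oU xpredT (sAc i)) Ux0).
  apply: eq_bigr => i _; rewrite (dird_sum _ (fun j => sAc i j) Ux0).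
  apply: eq_bigr => j _; rewrite (dird_mul _ (sD k (sA i j)) (scof i j) Ux0).
  by rewrite cof0 Dcof mulrN.
have E2 : K * (\sum_i a k i / lam i) = K * \sum_i \sum_j (DA i j) ^+ 2 / (lam i * lam j).
  apply/eqP; rewrite -subr_eq0; apply/eqP; rewrite -[RHS]E1 !mulr_sumr -sumrB.
  apply: eq_bigr => i _; rewrite sumrB; congr (_ - _).
    rewrite (bigD1 i)//= big1 ?addr0 => [|j ji]; last by rewrite (negbTE ji) mulr0.
    by rewrite eqxx mulr1n -/(a k i) mulrCA mulrA.
  rewrite mulr_sumr; apply: eq_bigr => j _; rewrite (DAs j i).
  have l1 := lt0r_neq0 (lam0 i); have l2 := lt0r_neq0 (lam0 j).
  by move: (DA i j) => D; field; exact/andP.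
rewrite -(pmulr_rge0 _ K0) E2 pmulr_rge0//; apply: sumr_ge0 => i _.
by apply: sumr_ge0 => j _; rewrite divr_ge0 ?sqr_ge0// mulr_ge0// ltW.
Qed.

Lemma umbilic_at_max i j : lam i = lam j.
Proof.
exact: (curvatures_equal lam0 fourth_derivative_sym derive2_shape0
  weighted_trace_derive2_shape0 trace_derive2_shape0).
Qed.

End ConstantCurvature.

(** * The shape operator of an immersion *)

Section LinearPart.
Variables (R : realType) (m n : nat).

Lemma posdef_unitmx (g : 'M[R]_m) :
  (forall v : 'rV_m, v != 0 -> 0 < dotv (v *m g) v) -> g \in unitmx.
Proof.
move=> gpos; rewrite -row_free_unit; apply: inj_row_free => v vg.
apply/eqP; apply: contraT => /gpos; by rewrite vg dotv0l ltxx.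
Qed.

Lemma gram_posdef (J : 'M[R]_(m, n)) : row_free J ->
  forall v : 'rV_m, v != 0 -> 0 < dotv (v *m (J *m J^T)) v.
Proof.
move=> Jf v v0; rewrite mulmxA dotv_mulmxl trmxK dotv_gt0//.
by apply: contra_neq v0 => vJ; apply: (row_free_inj Jf); rewrite vJ mul0mx.
Qed.

Lemma gram_sym (J : 'M[R]_(m, n)) : (J *m J^T)^T = J *m J^T.
Proof. by rewrite trmx_mul trmxK. Qed.

(** The row space of [J] fills the orthogonal complement of [u], since both have
    dimension [m]. *)
Lemma orthogonal_sub (J : 'M[R]_(m, m.+1)) (u w : 'rV[R]_m.+1) :
  row_free J -> u != 0 -> J *m u^T = 0 -> dotv w u = 0 -> (w <= J)%MS.
Proof.
move=> Jf u0 Ju wu.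
have sub : (J <= kermx u^T)%MS by rewrite sub_kermx Ju.
have rk : \rank (kermx u^T) = m.
  rewrite mxrank_ker mxrank_tr (_ : \rank u = 1%N) ?subn1//.
  by apply/eqP; rewrite eqn_leq rank_leq_row lt0n mxrank_eq0.
have := (mxrank_leqif_sup sub).2; rewrite rk (eqP Jf) eqxx => /esym sub'.
apply: submx_trans sub'; rewrite sub_kermx; apply/eqP/matrixP => i j.
by rewrite !ord1 -/(dotv _ _) wu mxE.
Qed.

End LinearPart.

Lemma mulmx_trE (R : realType) a b n (A : 'M[R]_(a, n)) (B : 'M[R]_(b, n)) i j :
  (A *m B^T) i j = dotv (row i A) (row j B).
Proof. by rewrite dotvE mxE; apply: eq_bigr => k _; rewrite !mxE. Qed.

Section ShapeOperator.
Variables (R : realType) (m : nat) (U : set 'rV[R]_m) (oU : open U).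
Variables (X nu : 'rV[R]_m -> 'rV[R]_m.+1).
Hypotheses (sX : smooth U X) (snu : smooth U nu).
Hypothesis Xfree : forall x, U x -> row_free ('J X x).
Hypothesis nu1 : forall x, U x -> dotv (nu x) (nu x) = 1.
Hypothesis nuX : forall x v, U x -> dotv (v *m 'J X x) (nu x) = 0.

Definition gram x := 'J X x *m ('J X x)^T.
Definition shape x := - 'J nu x *m pinvmx ('J X x).

Let dX x (Ux : U x) : differentiable X x := smooth_differentiable sX Ux.
Let dnu x (Ux : U x) : differentiable nu x := smooth_differentiable snu Ux.

Lemma derive_normal x v : U x -> dotv ('D_v nu x) (nu x) = 0.
Proof.
move=> Ux; have : 'D_v (fun y => dotv (nu y) (nu y)) x = 0.
  by rewrite (derive_ext oU v nu1 Ux) derive_const.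
rewrite derive_dotv; [|exact: dnu|exact: dnu].
by rewrite [X in _ + X]dotvC -mulr2n => /eqP; rewrite mulrn_eq0 => /eqP.
Qed.

Lemma tangentP x w : U x -> dotv w (nu x) = 0 -> (w <= 'J X x)%MS.
Proof.
move=> Ux; apply: orthogonal_sub; first exact: Xfree.
  by apply: contra_eq_neq (nu1 Ux) => ->; rewrite dotv0l eq_sym oner_neq0.
apply/row_matrixP => i; rewrite row_mul row0; apply/matrixP => a b.
by rewrite !ord1 -/(dotv _ _) rowE nuX// mxE.
Qed.

Lemma shape_jacobian x : U x -> shape x *m 'J X x = - 'J nu x.
Proof.
move=> Ux; rewrite mulmxKpV//; apply/row_subP => i.
apply: tangentP => //; rewrite linearN /= dotvNl.
by rewrite row_jacobian ?derive_normal ?oppr0//; exact: dnu.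
Qed.

Lemma shape_gram x : U x -> shape x *m gram x = - ('J nu x *m ('J X x)^T).
Proof. by move=> Ux; rewrite /gram mulmxA shape_jacobian// mulNmx. Qed.

Lemma shape_gram_coef x i j : U x ->
  (shape x *m gram x) i j =
    dotv (nu x) ('D_(delta_mx 0 i) ('D_(delta_mx 0 j) X) x).
Proof.
move=> Ux; rewrite shape_gram// mxE.
have sXj := smooth_derive (delta_mx 0 j) sX.
have : 'D_(delta_mx 0 i) (fun y => dotv (nu y) ('D_(delta_mx 0 j) X y)) x = 0.
  rewrite (derive_ext oU (g := fun=> 0)) ?derive_const// => y Uy.
  by rewrite dotvC deriveEjacobian ?nuX//; exact: dX.
rewrite derive_dotv; [|exact: dnu|exact: smooth_differentiable sXj Ux].
rewrite mulmx_trE (row_jacobian i (dnu Ux)) (row_jacobian j (dX Ux)).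
by move=> /eqP; rewrite addrC addr_eq0 => /eqP ->.
Qed.

Lemma shape_gram_sym x : U x -> (shape x *m gram x)^T = shape x *m gram x.
Proof.
move=> Ux; apply/matrixP => i j; rewrite mxE.
rewrite (shape_gram_coef i j Ux) (shape_gram_coef j i Ux).
have E := derive_commute_row oU (delta_mx 0 j) (delta_mx 0 i) sX Ux.
exact: (congr1 (dotv (nu x)) E).
Qed.

Lemma gram_unitmx x : U x -> gram x \in unitmx.
Proof. by move=> Ux; apply: posdef_unitmx; apply: gram_posdef; exact: Xfree. Qed.

Lemma smooth_jacobian n (f : 'rV[R]_m -> 'rV[R]_n) i j :
  smooth U f -> smooth U (fun x => 'J f x i j).
Proof.
move=> sf.
apply: (@smooth_ext _ _ _ oU _ (fun x => ('D_(delta_mx 0 i) f x) 0 j)).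
  move=> x Ux; rewrite -(row_jacobian i (smooth_differentiable sf Ux)).
  by rewrite [LHS]mxE.
exact: (smooth_entry oU 0 j (smooth_derive (delta_mx 0 i) sf)).
Qed.

Lemma smooth_gram i j : smooth U (fun x => gram x i j).
Proof.
apply: smooth_mulmx => // k l; first exact: smooth_jacobian.
apply: (@smooth_ext _ _ _ oU _ (fun x => 'J X x l k)); last exact: smooth_jacobian.
by move=> x _; rewrite [RHS]mxE.
Qed.

Lemma smooth_shape_gram i j : smooth U (fun x => (shape x *m gram x) i j).
Proof.
apply: (@smooth_ext _ _ _ oU _ (fun x =>
  dotv (nu x) ('D_(delta_mx 0 i) ('D_(delta_mx 0 j) X) x))).
  by move=> x Ux; rewrite shape_gram_coef.
by apply: smooth_dotv => //; do 2!apply: smooth_derive.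
Qed.

Lemma smooth_shape i j : smooth U (fun x => shape x i j).
Proof.
apply: (@smooth_ext _ _ _ oU _ (fun x => (shape x *m gram x *m invmx (gram x)) i j)).
  by move=> x Ux; rewrite mulmxK// gram_unitmx.
apply: smooth_mulmx => // k l; first exact: smooth_shape_gram.
by apply: smooth_invmx => //; [exact: smooth_gram|exact: gram_unitmx].
Qed.

End ShapeOperator.

(** * Normal coordinates at a point *)

Section QuadraticMap.
Variables (R : realType) (m : nat) (x0 : 'rV[R]_m).
Variables (p : 'I_m -> 'rV[R]_m) (b : 'I_m -> 'I_m -> 'rV[R]_m).
Implicit Types (v w y : 'rV[R]_m).

(** A change of coordinates with prescribed derivatives up to order two at the
    origin. *)
Definition quadratic_map y :=
  x0 + \sum_i y 0 i *: p i + \sum_i \sum_j (y 0 i * y 0 j) *: b i j.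

Lemma smooth_coord (U : set 'rV[R]_m) (j : 'I_m) :
  open U -> smooth U (fun y : 'rV[R]_m => y 0 j).
Proof.
move=> oU; apply: (@smooth_entry _ _ U oU 1 m id) => -[|k] //; split=> [x _|v].
  exact: ex_diff.
apply: (@kdiff_ext _ _ U oU _ k (fun=> v)); last exact: kdiff_cst.
by move=> x _; rewrite derive_id.
Qed.

Let dcoord (j : 'I_m) y : differentiable (fun z : 'rV[R]_m => z 0 j) y.
Proof. exact: differentiable_coord. Qed.

Lemma derive_coordinate j y v : 'D_v (fun z : 'rV[R]_m => z 0 j) y = v 0 j.
Proof. by rewrite (@derive_coord _ _ _ _ id)// derive_id. Qed.

Lemma smooth_quadratic_map (U : set 'rV[R]_m) : open U -> smooth U quadratic_map.
Proof.
move=> oU; apply: smoothD => //; first apply: smoothD => //.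
- exact: smooth_cst.
- by apply: smooth_sum => // i; apply: smooth_scale_cst => //; exact: smooth_coord.
- apply: smooth_sum => // i; apply: smooth_sum => // j; apply: smooth_scale_cst => //.
  by apply: smoothM => //; exact: smooth_coord.
Qed.

Lemma derive_quadratic_map v y : 'D_v quadratic_map y =
  \sum_i v 0 i *: p i +
    \sum_i \sum_j (v 0 i * y 0 j + y 0 i * v 0 j) *: b i j.
Proof.
have dz i : differentiable (fun z : 'rV[R]_m => z 0 i *: p i) y.
  exact: differentiableZl.
have dzz i j : differentiable (fun z : 'rV[R]_m => z 0 i * z 0 j) y.
  exact: differentiableM.
have dzb i j : differentiable (fun z : 'rV[R]_m => (z 0 i * z 0 j) *: b i j) y.
  exact: differentiableZl.
have dx : differentiable (fun z : 'rV[R]_m => x0) y by exact: differentiable_cst.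
rewrite /quadratic_map derive_add.
- rewrite (derive_add _ dx); last exact: differentiable_bigsum.
  rewrite derive_const add0r !derive_bigsum// => [|i]; last exact: differentiable_bigsum.
  congr (_ + _); apply: eq_bigr => i _; first by rewrite derive_scale_cst// derive_coordinate.
  rewrite derive_bigsum//; apply: eq_bigr => j _.
  by rewrite derive_scale_cst// derive_mul// !derive_coordinate.
- by apply: differentiableD => //; exact: differentiable_bigsum.
- by apply: differentiable_bigsum => i; exact: differentiable_bigsum.
Qed.

Lemma quadratic_map0 : quadratic_map 0 = x0.
Proof.
rewrite /quadratic_map !big1 ?addr0// => i _; last by rewrite mxE scale0r.
by rewrite big1// => j _; rewrite mxE mul0r scale0r.
Qed.

Lemma derive_quadratic_map0 i : 'D_(delta_mx 0 i) quadratic_map 0 = p i.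
Proof.
rewrite derive_quadratic_map (bigD1 i)//= big1 ?addr0 => [|j ji]; last first.
  by rewrite mxE (negbTE ji) andbF scale0r.
rewrite mxE !eqxx scale1r big1 ?addr0// => j _; rewrite big1// => k _.
by rewrite ![(0 : 'rV__) _ _]mxE mulr0 mul0r addr0 scale0r.
Qed.

Lemma derive2_quadratic_map0 i j :
  'D_(delta_mx 0 i) ('D_(delta_mx 0 j) quadratic_map) 0 = b i j + b j i.
Proof.
rewrite (_ : 'D_(delta_mx 0 j) quadratic_map = fun y =>
  p j + \sum_k y 0 k *: (b j k + b k j)); last first.
  apply/funext => y; rewrite derive_quadratic_map; congr (_ + _).
    rewrite (bigD1 j)//= big1 ?addr0 => [|k kj]; first by rewrite mxE !eqxx scale1r.
    by rewrite mxE (negbTE kj) andbF scale0r.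
  under eq_bigr do under eq_bigr do rewrite scalerDl.
  under eq_bigr do rewrite big_split /=.
  rewrite big_split /= (bigD1 j)//= [X in _ + X + _]big1 ?addr0 => [|k kj]; last first.
    by apply: big1 => l _; rewrite mxE (negbTE kj) andbF mul0r scale0r.
  rewrite -big_split /=; apply: eq_bigr => k _; rewrite mxE !eqxx mul1r scalerDr.
  congr (_ + _); rewrite (bigD1 j)//= big1 ?addr0 => [|l lj].
    by rewrite mxE !eqxx mulr1.
  by rewrite mxE (negbTE lj) andbF mulr0 scale0r.
rewrite derive_add; last 2 first.
- exact: differentiable_cst.
- by apply: differentiable_bigsum => k; exact: differentiableZl.
rewrite derive_const add0r derive_bigsum => [|k]; last exact: differentiableZl.
rewrite (bigD1 i)//= big1 ?addr0 => [|k ki].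
  by rewrite derive_scale_cst// derive_coordinate mxE !eqxx scale1r addrC.
by rewrite derive_scale_cst// derive_coordinate mxE (negbTE ki) andbF scale0r.
Qed.

End QuadraticMap.

Section ScaledField.
Variables (R : realType) (m n : nat) (U : set 'rV[R]_m) (oU : open U).
Variables (a : 'rV[R]_m -> R) (G : 'rV[R]_m -> 'rV[R]_n).
Hypotheses (sa : smooth U a) (sG : smooth U G).

Lemma smooth_scale : smooth U (fun y => a y *: G y).
Proof.
apply: smooth_row => // j.
apply: (@smooth_ext _ _ _ oU _ (fun y => a y * G y 0 j)).
  by move=> x _; rewrite mxE.
by apply: smoothM => //; exact: smooth_entry.
Qed.

Lemma derive_scale_field x v : U x ->
  'D_v (fun y => a y *: G y) x = 'D_v a x *: G x + a x *: 'D_v G x.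
Proof.
move=> Ux; apply/rowP => j.
rewrite -derive_coord; last exact: smooth_differentiable smooth_scale Ux.
have -> : (fun y => (a y *: G y) 0 j) = (fun y => a y * G y 0 j).
  by apply/funext => y; rewrite mxE.
have dG := smooth_differentiable sG Ux.
rewrite derive_mul; [|exact: smooth_differentiable sa Ux|exact: differentiable_entry].
by rewrite (derive_coord v 0 j dG) !mxE.
Qed.

End ScaledField.

Section MaximumPoint.
Variables (R : realType) (m : nat) (U : set 'rV[R]_m) (oU : open U).
Variables (X nu : 'rV[R]_m -> 'rV[R]_m.+1) (x0 : 'rV[R]_m) (Ux0 : U x0).
Hypotheses (sX : smooth U X) (snu : smooth U nu).
Hypothesis Xfree : forall x, U x -> row_free ('J X x).
Hypothesis nu1 : forall x, U x -> dotv (nu x) (nu x) = 1.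
Hypothesis nuX : forall x v, U x -> dotv (v *m 'J X x) (nu x) = 0.
Local Notation S := (shape X nu).
Local Notation g := (gram X).
Hypothesis hpos : forall v : 'rV_m, v != 0 -> 0 < dotv (v *m (S x0 *m g x0)) v.
Variable K : R.
Hypothesis detS : forall x, U x -> \det (S x) = K.
Hypothesis trS : forall x, U x -> \tr (S x) <= \tr (S x0).

(** In the coordinates of the quadratic map below, the Christoffel symbols of
    the first fundamental form vanish at the origin: the quadratic coefficients
    cancel the tangential parts of the second derivatives of [X]. *)
Lemma shape_scalar_at_max : exists mu, S x0 = mu%:M.
Proof.
have [P [d [Pg Ph]]] := simultaneous_diagonalization (gram_sym ('J X x0))
  (shape_gram_sym oU sX snu Xfree nu1 nuX Ux0) (gram_posdef (Xfree Ux0)).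
rewrite -/(gram X x0) in Pg.
pose p i := row i P.
pose w i j := 'D_(p i) ('D_(p j) X) x0.
pose tang i j := w i j - dotv (w i j) (nu x0) *: nu x0.
pose b i j := - (2^-1 *: (tang i j *m pinvmx ('J X x0))).
have ws i j : w i j = w j i := derive_commute_row oU (p i) (p j) sX Ux0.
have bJ i j : (b i j + b j i) *m 'J X x0 = - tang i j.
  have tE : tang j i = tang i j by rewrite /tang (ws j i).
  rewrite /b tE -opprD -scalerDl (_ : 2^-1 + 2^-1 = 1); last by field.
  rewrite scale1r mulNmx; congr (- _); apply: mulmxKpV.
  apply: (tangentP Xfree nu1 nuX Ux0).
  by rewrite dotvDl dotvNl dotvZl (nu1 Ux0) mulr1 subrr.
pose phi := quadratic_map x0 p b.
have sphi V : open V -> smooth V phi := @smooth_quadratic_map _ _ x0 p b V.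
have dphi y : differentiable phi y by exact: smooth_differentiable (sphi _ openT) I.
pose F y := \matrix_i 'D_(delta_mx 0 i) phi y.
have sF V i j : open V -> smooth V (fun y => F y i j).
  move=> oV; apply: (@smooth_ext _ _ _ oV _ (fun y => ('D_(delta_mx 0 i) phi y) 0 j)).
    by move=> y _; rewrite mxE.
  by apply: smooth_entry => //; apply: smooth_derive; exact: sphi.
have phi0 : phi 0 = x0 := quadratic_map0 x0 p b.
have F0 : F 0 = P.
  by apply/row_matrixP => i; rewrite rowK; exact: derive_quadratic_map0.
pose U' := (phi @^-1` U) `&` [set y | \det (F y) != 0].
have oU' : open U'.
  apply: openI.
    by apply: open_comp => // y _; exact: differentiable_continuous.
  apply: (@open_comp _ _ (fun y => \det (F y)) [set z : R | z != 0]).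
    move=> y _; apply: differentiable_continuous.
    apply: (smooth_differentiable (U := setT)) => //.
    by apply: smooth_determinant => [|i j]; [exact: openT|apply: sF; exact: openT].
  exact: open_neq.
have U'0 : U' 0.
  split; rewrite /= ?phi0// F0.
  have /mulmx1_unit[+ _] : P *m (g x0 *m P^T) = 1%:M by rewrite mulmxA.
  by rewrite unitmxE unitfE.
have uF y : U' y -> F y \in unitmx by case=> _; rewrite /= unitmxE unitfE.
have phiU y : U' y -> U (phi y) by case.
have sphi' := sphi _ oU'.
pose Y := X \o phi; pose nu' := nu \o phi.
have sY : smooth U' Y := smooth_comp_row oU' sphi' phiU oU sX.
have snu' : smooth U' nu' := smooth_comp_row oU' sphi' phiU oU snu.
have dcomp (f : 'rV[R]_m -> 'rV[R]_m.+1) y i : smooth U f -> U' y ->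
    dird (delta_mx 0 i) (f \o phi) y = row i (F y *m 'J f (phi y)).
  move=> sf Uy; have df := smooth_differentiable sf (phiU _ Uy).
  by rewrite dirdE derive_comp// deriveEjacobian// row_mul rowK.
pose A y := F y *m S (phi y) *m invmx (F y).
have gY y i j : U' y -> dotv (dird (delta_mx 0 i) Y y) (dird (delta_mx 0 j) Y y)
    = (F y *m g (phi y) *m (F y)^T) i j.
  move=> Uy; rewrite !(dcomp X)// -mulmx_trE; congr (fun_of_matrix _ i j).
  by rewrite /gram trmx_mul !mulmxA.
have hY y i j : U' y -> - dotv (dird (delta_mx 0 i) nu' y) (dird (delta_mx 0 j) Y y)
    = (F y *m (S (phi y) *m g (phi y)) *m (F y)^T) i j.
  move=> Uy; rewrite (dcomp nu)// (dcomp X)// -mulmx_trE.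
  rewrite (shape_gram oU snu Xfree nu1 nuX (phiU _ Uy)) trmx_mul mulmxN mulNmx !mulmxA.
  by rewrite [RHS]mxE.
have AgY y : U' y -> A y *m (F y *m g (phi y) *m (F y)^T) =
    F y *m (S (phi y) *m g (phi y)) *m (F y)^T.
  by move=> Uy; rewrite /A !mulmxA mulmxKV// uF.
have sS i j : smooth U (fun x => S x i j) := smooth_shape oU sX snu Xfree nu1 nuX i j.
have sFS k l : smooth U' (fun y => (F y *m S (phi y)) k l).
  exact: (smooth_mulmx oU' (fun i j => sF U' i j oU')
    (fun i j => smooth_comp oU' sphi' phiU (sS i j))).
have sFV := smooth_invmx oU' (fun i j => sF U' i j oU') uF.
have sA i j : smooth U' (fun y => A y i j) := smooth_mulmx oU' sFS sFV i j.
have trAS y : U' y -> \tr (A y) = \tr (S (phi y)).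
  by move=> Uy; rewrite /A mxtrace_mulC mulmxA mulVmx ?uF// mul1mx.
have detAS y : U' y -> \det (A y) = K.
  move=> Uy; rewrite -(detS (phiU _ Uy)) /A !det_mulmx det_inv mulrAC divff ?mul1r//.
  by case: Uy.
have lam0 i : 0 < d 0 i.
  have rP : row i P != 0.
    apply/eqP => Pi; have := congr1 (row i) Pg.
    rewrite -mulmxA row_mul Pi mul0mx => /rowP/(_ i); rewrite !mxE eqxx => /eqP.
    by rewrite eq_sym oner_eq0.
  by have := hpos rP; rewrite -row_mul -mulmx_trE Ph mxE eqxx mulr1n.
have Y20 i j k : dotv (dird (delta_mx 0 i) (dird (delta_mx 0 j) Y) 0)
    (dird (delta_mx 0 k) Y 0) = 0.
  have sXl l := smooth_derive (delta_mx 0 l : 'rV[R]_m) sX.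
  have sXlphi l := smooth_comp_row oU' sphi' phiU oU (sXl l).
  have sphij := smooth_derive (delta_mx 0 j) sphi'.
  have sphijl l := smooth_entry oU' 0 l sphij.
  have E y : U' y -> dird (delta_mx 0 j) Y y = \sum_l ('D_(delta_mx 0 j) phi y) 0 l *:
      ('D_(delta_mx 0 l) X \o phi) y.
    move=> Uy; have dX := smooth_differentiable sX (phiU _ Uy).
    by rewrite dirdE derive_comp// (derive_row_expansion _ dX).
  have sE l := smooth_scale oU' (sphijl l) (sXlphi l).
  have -> : dird (delta_mx 0 i) (dird (delta_mx 0 j) Y) 0 = w i j - tang i j.
    rewrite (dird_ext oU' _ E U'0) (dird_sum _ sE U'0).
    have dXx := smooth_differentiable sX Ux0.
    rewrite -bJ addrC -(deriveEjacobian _ dXx).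
    rewrite -(derive2_quadratic_map0 x0 p b i j) -/phi.
    rewrite (derive_row_expansion _ dXx).
    have -> : w i j = \sum_l (p j) 0 l *: 'D_(p i) ('D_(delta_mx 0 l) X) x0.
      have dXl l := smooth_differentiable (sXl l) Ux0.
      rewrite /w (derive_ext oU (g := fun y => \sum_l (p j) 0 l *: 'D_(delta_mx 0 l) X y)) //.
        rewrite derive_bigsum => [|l]; last exact: differentiableZ.
        by apply: eq_bigr => l _; rewrite -deriveZ//; exact: diff_derivable.
      move=> y Uy; exact: derive_row_expansion (smooth_differentiable sX Uy).
    rewrite -big_split; apply: eq_bigr => l _ /=.
    rewrite dirdE (derive_scale_field oU' (sphijl l) (sXlphi l) _ U'0).
    rewrite (derive_comp _ (dphi 0)); last first.
      by rewrite phi0; exact: smooth_differentiable (sXl l) Ux0.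
    rewrite /= phi0 (derive_quadratic_map0 x0 p b i) (derive_quadratic_map0 x0 p b j).
    congr (_ *: _ + _).
    by apply: derive_coord; exact: smooth_differentiable sphij U'0.
  by rewrite /tang subKr dotvZl (dcomp X)// phi0 row_mul [X in _ * X]dotvC (nuX _ Ux0) mulr0.
have Agh y i j : U' y ->
    \sum_l A y i l * dotv (dird (delta_mx 0 l) Y y) (dird (delta_mx 0 j) Y y) =
    - dotv (dird (delta_mx 0 i) nu' y) (dird (delta_mx 0 j) Y y).
  move=> Uy; rewrite hY// -AgY// [RHS]mxE; apply: eq_bigr => l _.
  by rewrite gY.
have g0 i j : dotv (dird (delta_mx 0 i) Y 0) (dird (delta_mx 0 j) Y 0) = (i == j)%:R.
  by rewrite gY// F0 phi0 Pg mxE.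
have h0 i j : - dotv (dird (delta_mx 0 i) nu' 0) (dird (delta_mx 0 j) Y 0) = d 0 i *+ (i == j).
  by rewrite hY// F0 phi0 Ph mxE.
have nuY' y i : U' y -> dotv (dird (delta_mx 0 i) Y y) (nu' y) = 0.
  by move=> Uy; rewrite (dcomp X)// row_mul (nuX _ (phiU _ Uy)).
have trA y : U' y -> \tr (A y) <= \tr (A 0).
  have e0 : \tr (A 0) = \tr (S x0).
    exact: (etrans (trAS _ U'0) (congr1 (fun z => \tr (S z)) phi0)).
  have le_eq (z1 z2 z3 z4 : R) : z1 = z2 -> z4 = z3 -> z2 <= z3 -> z1 <= z4.
    by move=> -> ->.
  by move=> Uy; exact: (le_eq _ _ _ _ (trAS _ Uy) e0 (trS (phiU _ Uy))).
have deq i j : d 0 i = d 0 j := umbilic_at_max oU' U'0 sY snu' sA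
  (fun y Uy => nu1 (phiU y Uy)) nuY' Agh lam0 detAS trA g0 h0 Y20 i j.
pose mu := if [pick i : 'I_m] is Some i then d 0 i else 0.
have dmu : diag_mx d = mu%:M.
  apply/matrixP => i j; rewrite !mxE /mu.
  by case: pickP => [k _|/(_ i)//]; rewrite (deq i k).
exists mu; apply: (can_inj (mulmxK (gram_unitmx Xfree Ux0))).
have uP : P \in unitmx by rewrite -F0; exact: uF.
apply: (can_inj (mulKmx uP)); apply: (can_inj (mulmxK (_ : P^T \in unitmx))).
  by rewrite unitmx_tr.
by rewrite Ph dmu mul_scalar_mx -scalemxAr -scalemxAl Pg scalemx1.
Qed.

End MaximumPoint.

(** * Functions on a hypersurface *)

Lemma mulmx_lipschitz (R : realType) a b (B : 'M[R]_(a, b)) :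
  exists2 C : R, 0 < C & forall u : 'rV[R]_a, `|u *m B| <= C * `|u|.
Proof.
have cB : continuous (mulmxr B : 'rV[R]_a -> 'rV[R]_b).
  move=> x; exact: continuous_mulmxr.
have [C C0 CP] := linear_lipschitz cB.
by exists C.
Qed.

Lemma le0_small_multiple (R : realType) (z D e1 : R) : 0 <= D -> 0 < e1 ->
  (forall e, 0 < e -> e <= e1 -> z <= e * D) -> z <= 0.
Proof.
move=> D0 e10 small; apply/ler_addgt0Pl => e e0; rewrite addr0.
have D1 : 0 < D + 1 by rewrite ltr_wpDl.
pose e' := Num.min (e / (D + 1)) e1.
have e'0 : 0 < e' by rewrite lt_min divr_gt0.
apply: le_trans (small e' e'0 _) _; first by rewrite ge_min lexx orbT.
apply: (@le_trans _ _ (e' * (D + 1))); first by rewrite ler_pM2l// lerDl.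
by rewrite -ler_pdivlMr// ge_min lexx.
Qed.

Lemma small_multiple (R : realType) (V : normedModType R) (v : V) (d : R) :
  0 < d -> exists2 t : R, 0 < t & `|t *: v| < d.
Proof.
move=> d0; have a1 : 0 < `|v| + 1 by rewrite ltr_wpDl.
exists (d / (2 * (`|v| + 1))); first by rewrite divr_gt0// mulr_gt0.
rewrite normrZ gtr0_norm ?divr_gt0 ?mulr_gt0// mulrAC ltr_pdivrMr ?mulr_gt0//.
by rewrite ltr_pM2l//; have := normr_ge0 v; lra.
Qed.

Section Charts.
Variables (R : realType) (m : nat).
Variables (M : set 'rV[R]_m.+1) (N : 'rV[R]_m.+1 -> 'rV[R]_m.+1).
Hypothesis uN : unit_normal_field M N.
Implicit Types (U V : set 'rV[R]_m) (X Y : 'rV[R]_m -> 'rV[R]_m.+1).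
Implicit Types (x y v : 'rV[R]_m).

Section OneChart.
Variables (U : set 'rV[R]_m) (X : 'rV[R]_m -> 'rV[R]_m.+1).
Hypothesis cX : local_parametrization M U X.

Lemma chart_open : open U. Proof. by case: cX. Qed.
Lemma chart_smooth : smooth U X. Proof. by case: cX => _ /smooth_onW. Qed.
Lemma chart_free x : U x -> row_free ('J X x).
Proof. by case: cX => _ _ + _ _; exact. Qed.
Lemma chart_normal_smooth : smooth U (N \o X).
Proof. exact/smooth_onW/(uN cX).1. Qed.
Lemma chart_normal1 x : U x -> dotv (N (X x)) (N (X x)) = 1.
Proof. by move=> /(uN cX).2 []. Qed.
Lemma chart_normal0 x v : U x -> dotv (v *m 'J X x) (N (X x)) = 0.
Proof. by move=> /(uN cX).2 [_]. Qed.

Lemma chart_in x : U x -> M (X x).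
Proof.
move=> Ux; case: cX => oU _ _ _ /(_ U oU (fun _ h => h)) [W _ E].
have : (X @` U) (X x) by exists x.
by rewrite E => -[].
Qed.

Lemma chart_image_open x (P : set 'rV[R]_m) : U x -> nbhs x P ->
  exists W, [/\ open W, W (X x) &
    forall p, M p -> W p -> exists y, [/\ U y, P y & X y = p]].
Proof.
move=> Ux Px; pose Q := U `&` P°.
have oQ : open Q by apply: openI; [exact: chart_open|exact: open_interior].
have Qx : Q x by split=> //; exact: Px.
case: cX => _ _ _ _ /(_ Q oQ (fun _ h => h.1)) [W oW E].
exists W; split=> //.
  have : (X @` Q) (X x) by exists x.
  by rewrite E => -[].
move=> p Mp Wp; have : (M `&` W) p by [].
rewrite -E => -[y [Uy Py] yp]; exists y; split=> //.
exact: interior_subset Py.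
Qed.

End OneChart.

(** The two parametrizations of a neighbourhood of a point are compared without
    their transition map. Along the line [x + t v] the second coordinates
    [y + k] satisfy [k = t w + o(t)], because ['J Y y] is injective, where [w]
    represents in the second chart the tangent vector of [v]. *)
Lemma normal_derivative_invariant U X x V Y y v w :
  local_parametrization M U X -> local_parametrization M V Y -> U x -> V y ->
  X x = Y y -> v *m 'J X x = w *m 'J Y y ->
  v *m 'J (N \o X) x = w *m 'J (N \o Y) y.
Proof.
move=> cX cY Ux Vy XY vw.
have dX := smooth_differentiable (chart_smooth cX) Ux.
have dY := smooth_differentiable (chart_smooth cY) Vy.
have dNX := smooth_differentiable (chart_normal_smooth cX) Ux.
have dNY := smooth_differentiable (chart_normal_smooth cY) Vy.
have freeY := chart_free cY Vy.
have DX u := deriveEjacobian u dX; have DY u := deriveEjacobian u dY.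
have DNX u := deriveEjacobian u dNX; have DNY u := deriveEjacobian u dNY.
move: DX DY DNX DNY vw freeY.
move: ('J X x) ('J Y y) ('J (N \o X) x) ('J (N \o Y) y).
move=> JX JY JNX JNY DX DY DNX DNY vw freeY.
have [C C0 CP] := mulmx_lipschitz (pinvmx JY).
have [L L0 LP] := mulmx_lipschitz JNY.
set q := v *m _; set q' := w *m _.
pose a := `|v|; pose B := 2 * `|w| + a.
have a0 : 0 <= a := normr_ge0 v.
have B0 : 0 <= B by rewrite addr_ge0// mulr_ge0.
suff small (e : R) : 0 < e -> e <= (2 * C)^-1 -> `|q - q'| <= e * ((a + B) * (1 + L * C)).
  apply/eqP; rewrite -subr_eq0 -normr_le0; apply: (le0_small_multiple _ _ small).
    by rewrite mulr_ge0 ?addr_ge0 ?mulr_ge0 ?(ltW C0) ?(ltW L0).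
  by rewrite invr_gt0 mulr_gt0.
move=> e0 eC.
have [d1 d10 d1P] := differentiable_expansion e0 dX.
have [d2 d20 d2P] := differentiable_expansion e0 dY.
have [d3 d30 d3P] := differentiable_expansion e0 dNX.
have [d4 d40 d4P] := differentiable_expansion e0 dNY.
pose d24 := Num.min d2 d4.
have d240 : 0 < d24 by rewrite lt_min d20.
have [W [oW Wx WP]] := chart_image_open cY Vy (nbhsx_ballx y _ d240).
have XW : nbhs x (X @^-1` W).
  by apply: (differentiable_continuous dX); apply: open_nbhs_nbhs; split; rewrite ?XY.
have [d5 d50 d5P] := nbhs_small_segment XW.
have [d6 d60 d6P] := nbhs_small_segment (near_open (chart_open cX) Ux).
pose d := Num.min (Num.min d1 d3) (Num.min d5 d6).
have d0 : 0 < d by rewrite !lt_min d10 d30 d50 d60.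
have [t t0 tv] := small_multiple v d0.
have := tv; rewrite !lt_min => /andP[/andP[t1 t3] /andP[t5 t6]].
have [y' [Vy' yy' XY']] := WP _ (chart_in cX (d6P _ t6)) (d5P _ t5).
pose k := y' - y.
have y'E : y' = y + k by rewrite addrC subrK.
have : `|k| < d24 by move: yy'; rewrite -ball_normE /= distrC.
rewrite lt_min => /andP[k2 k4].
have e1 := d1P _ t1; have e2 := d2P _ k2; have e3 := d3P _ t3; have e4 := d4P _ k4.
clearbody k.
rewrite -y'E XY' in e2; rewrite /= -y'E XY' in e4.
have nt u : `|t *: u| = t * `|u| :> R.
  by rewrite normrZ gtr0_norm.
rewrite DX -scalemxAl vw nt -/a in e1.
rewrite DNX -scalemxAl -/q nt -/a in e3.
rewrite DY -XY in e2.
rewrite DNY -XY in e4.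
move: e1 e3 e2 e4; move: (X (x + t *: v) - X x) => z; rewrite /=.
move: (N (X (x + t *: v)) - N (X x)) => zn e1 e3 e2 e4.
have kw : `|k - t *: w| <= C * (e * (`|k| + t * a)).
  have -> : k - t *: w = (k - t *: w) *m JY *m pinvmx (JY).
    by rewrite -mulmxA mulmxVp ?mulmx1//; exact: freeY.
  apply: le_trans (CP _) _; rewrite ler_pM2l//.
  rewrite mulmxBl -scalemxAl.
  have -> : k *m JY - t *: (w *m JY) =
    (z - t *: (w *m JY)) - (z - k *m JY) by rewrite opprB [RHS]addrC addrA subrK.
  by rewrite (le_trans (ler_normB _ _))// mulrDr addrC lerD.
have kB : `|k| <= t * B.
  have : `|k| <= t * `|w| + C * (e * (`|k| + t * a)).
    apply: le_trans (lerD (lexx _) kw).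
    have -> : t * `|w| = `|t *: w| by rewrite normrZ gtr0_norm.
    by rewrite (le_trans _ (ler_normD _ _))// addrC subrK.
  have : C * (e * (`|k| + t * a)) <= (`|k| + t * a) / 2.
    rewrite mulrA mulrC ler_wpM2l ?addr_ge0 ?mulr_ge0 ?(ltW t0)//.
    by rewrite -ler_pdivlMl// -invfM mulrC.
  rewrite /B; move: (`|k|) (`|w|) (a) => K W' a' h1 h2; lra.
have {}kw : `|k - t *: w| <= t * (C * (e * (a + B))).
  apply: le_trans kw _; rewrite (mulrCA t) (mulrCA t) ler_pM2l// ler_pM2l//.
  by rewrite mulrDr addrC lerD.
have : `|t *: (q - q')| <= t * (e * ((a + B) * (1 + L * C))).
  have -> : t *: (q - q') = - (zn - t *: q) + (zn - k *m JNY) +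
      (k - t *: w) *m JNY.
    rewrite scalerBr mulmxBl -scalemxAl -/q' opprB.
    by rewrite !addrA !subrK.
  apply: le_trans (ler_normD _ _) _.
  have := le_trans (LP _) (ler_wpM2l (ltW L0) kw).
  have := ler_normD (- (zn - t *: q)) (zn - k *m JNY).
  rewrite normrN.
  have : e * `|k| <= e * (t * B) by rewrite ler_pM2l.
  move: e3 e4.
  move: (`|zn - t *: q|) (`|zn - k *m JNY|) (`|k|) => n1 n2 n3.
  move: (`|_ + _|) (`|_ *m _|) => n4 n5.
  move: (a) (B) => a' B' h1 h2 h3 h4 h5.
  have -> : t * (e * ((a' + B') * (1 + L * C))) =
    (e * (t * a') + e * (t * B')) + L * (t * (C * (e * (a' + B')))) by ring.
  by apply: lerD => //; apply: le_trans h4 _; apply: lerD => //; exact: le_trans h3.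
by rewrite normrZ gtr0_norm// ler_pM2l.
Qed.

End Charts.

Section GlobalFunctions.
Variables (R : realType) (m : nat).
Variables (M : set 'rV[R]_m.+1) (N : 'rV[R]_m.+1 -> 'rV[R]_m.+1).
Hypothesis uN : unit_normal_field M N.
Implicit Types (U V : set 'rV[R]_m) (X Y : 'rV[R]_m -> 'rV[R]_m.+1).
Implicit Types (x y v : 'rV[R]_m).

(** Both charts have the normal space spanned by [N] at the common point, hence
    the same tangent space; [P] is the change of basis between their coordinate
    frames. *)
Lemma shape_similar U X x V Y y :
  local_parametrization M U X -> local_parametrization M V Y -> U x -> V y ->
  X x = Y y -> exists2 P, P \in unitmx &
    shape_operator N X x = P *m shape_operator N Y y *m invmx P.
Proof.
move=> cX cY Ux Vy XY.
have SX : shape_operator N X x *m 'J X x = - 'J (N \o X) x.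
  exact: (shape_jacobian (chart_open cX) (chart_normal_smooth uN cX) (chart_free cX)
    (chart_normal1 uN cX) (fun x v Ux => chart_normal0 uN cX v Ux) Ux).
have SY : shape_operator N Y y *m 'J Y y = - 'J (N \o Y) y.
  exact: (shape_jacobian (chart_open cY) (chart_normal_smooth uN cY) (chart_free cY)
    (chart_normal1 uN cY) (fun x v Ux => chart_normal0 uN cY v Ux) Vy).
have sub : ('J X x <= 'J Y y)%MS.
  apply/row_subP => i.
  apply: (tangentP (chart_free cY) (chart_normal1 uN cY)
    (fun x v Ux => chart_normal0 uN cY v Ux) Vy).
  by rewrite /= -XY rowE (chart_normal0 uN cX).
have inv v w := @normal_derivative_invariant _ _ _ _ uN _ _ x _ _ y v w cX cY Ux Vy XY.
have fX := chart_free cX Ux; have fY := chart_free cY Vy.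
move: SX SY sub inv fX fY; move: (shape_operator _ _ _) (shape_operator _ _ _).
move: ('J X x) ('J Y y) ('J (N \o X) x) ('J (N \o Y) y).
move=> JX JY JNX JNY SY SX EX EY sub inv fX fY.
pose P := JX *m pinvmx JY.
have PJ : P *m JY = JX by rewrite /P mulmxKpV.
have PN : P *m JNY = JNX.
  apply/row_matrixP => i; rewrite row_mul [RHS]rowE; apply/esym/inv.
  by rewrite -rowE -row_mul PJ.
clearbody P.
have uP : P \in unitmx.
  rewrite -row_free_unit; apply: inj_row_free => v vP; apply: (row_free_inj fX).
  by rewrite mul0mx -PJ mulmxA vP mul0mx.
exists P => //.
have SP : SX *m P = P *m SY.
  by apply: (row_free_inj fY); rewrite /= -!mulmxA PJ EX EY mulmxN PN.
by rewrite -SP mulmxK.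
Qed.

Lemma trace_invariant U X x V Y y :
  local_parametrization M U X -> local_parametrization M V Y -> U x -> V y ->
  X x = Y y -> \tr (shape_operator N X x) = \tr (shape_operator N Y y).
Proof.
move=> cX cY Ux Vy XY; have [P uP ->] := shape_similar cX cY Ux Vy XY.
by rewrite mxtrace_mulC mulmxA mulVmx// mul1mx.
Qed.

Lemma det_invariant U X x V Y y :
  local_parametrization M U X -> local_parametrization M V Y -> U x -> V y ->
  X x = Y y -> \det (shape_operator N X x) = \det (shape_operator N Y y).
Proof.
move=> cX cY Ux Vy XY; have [P uP ->] := shape_similar cX cY Ux Vy XY.
rewrite !det_mulmx det_inv mulrAC divff ?mul1r//.
by move: uP; rewrite unitmxE unitfE.
Qed.

Hypotheses (hM : hypersurface M) (cM : compact M).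

(** A continuous function that is given in charts, and whose value does not
    depend on the chart, descends to [M] and attains its maximum there. *)
Lemma chart_max (Q : ('rV[R]_m -> 'rV[R]_m.+1) -> 'rV[R]_m -> R) :
  (forall U X x V Y y, local_parametrization M U X ->
    local_parametrization M V Y -> U x -> V y -> X x = Y y -> Q X x = Q Y y) ->
  (forall U X x, local_parametrization M U X -> U x -> {for x, continuous (Q X)}) ->
  exists U X x, [/\ local_parametrization M U X, U x &
    forall V Y y, local_parametrization M V Y -> V y -> Q Y y <= Q X x].
Proof.
move=> Qinv Qcont; have [M0 _ charts] := hM.
have /choice[q qP] : forall p, exists r : R, forall U X x,
    local_parametrization M U X -> U x -> X x = p -> Q X x = r.
  move=> p; have [Mp|Mp] := pselect (M p); last first.
    by exists 0 => U X x cX Ux Xp; case: Mp; rewrite -Xp; apply: (chart_in cX).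
  have [V [Y [cY [y Vy Yp]]]] := charts p Mp.
  exists (Q Y y) => U X x cX Ux Xp; apply: Qinv cX cY Ux Vy _.
  by rewrite Xp Yp.
have qE U X x : local_parametrization M U X -> U x -> Q X x = q (X x).
  by move=> cX Ux; exact: qP cX Ux erefl.
have [|p Mp pmax] := compact_EVT_max M0 cM (f := q).
  apply/subspace_continuousP => p Mp.
  have [U [X [cX [x Ux Xp]]]] := charts p Mp.
  apply/cvgrPdist_lt => e e0.
  have /cvgrPdist_lt/(_ _ e0) Qe := Qcont _ _ _ cX Ux.
  have [W [oW Wx WP]] := chart_image_open cX Ux Qe.
  rewrite Xp in Wx.
  have Wp : nbhs p W by apply: open_nbhs_nbhs.
  rewrite near_withinE; apply: filterS Wp => p' Wp' Mp'.
  have [y [Uy Qy <-]] := WP _ Mp' Wp'.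
  by rewrite /= -Xp /from_subspace -(qE _ _ _ cX Ux) -(qE _ _ _ cX Uy).
rewrite inE in Mp.
have [U [X [cX [x Ux Xp]]]] := charts p Mp.
exists U, X, x; split=> // V Y y cY Vy.
rewrite (qE _ _ _ cX Ux) (qE _ _ _ cY Vy) Xp; apply: pmax.
by apply/mem_set; apply: (chart_in cY).
Qed.

(** Openness in the domains of all charts is openness in [M], because charts
    map open sets to relatively open sets. *)
Lemma chart_connected (P : set 'rV[R]_m.+1) :
  (forall U X x, local_parametrization M U X -> U x -> P (X x) ->
    \forall y \near x, P (X y)) ->
  (forall U X x, local_parametrization M U X -> U x -> ~ P (X x) ->
    \forall y \near x, ~ P (X y)) ->
  (exists2 p, M p & P p) -> forall p, M p -> P p.
Proof.
move=> oP oNP [p0 Mp0 Pp0] p Mp; have [_ conn charts] := hM.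
have op (S : set 'rV[R]_m.+1) : (forall U X x, local_parametrization M U X -> U x ->
    S (X x) -> \forall y \near x, S (X y)) ->
    exists2 C, open C & M `&` S = M `&` C.
  move=> oS.
  exists (\bigcup_(W in [set W | open W /\ M `&` W `<=` S]) W).
    by apply: bigcup_open => W [].
  apply/seteqP; split=> p' [Mp' Sp']; split=> //; last first.
    by case: Sp' => W [_ WS] Wp'; exact: WS.
  have [U [X [cX [x Ux Xp]]]] := charts p' Mp'.
  rewrite -Xp in Sp' *.
  have [W [oW Wx WP]] := chart_image_open cX Ux (oS _ _ _ cX Ux Sp').
  exists W => //; split=> // q [Mq Wq].
  by have [y [_ Sy <-]] := WP _ Mq Wq.
have [C oC EC] := op _ oP.
have [D oD ED] := op (~` P) oNP.
have -> : P p <-> (M `&` P) p by split=> // -[].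
suff -> : M `&` P = M by [].
apply: conn.
- by exists p0.
- by exists C.
- exists (~` D); first exact: open_closedC.
  apply/seteqP; split=> q [Mq].
    by move=> Pq; split=> // Dq; have : (M `&` D) q by []; rewrite -ED => -[].
  move=> nD; split=> //; apply: contrapT => nP; apply: nD.
  by have : (M `&` ~` P) q by []; rewrite ED => -[].
Qed.

End GlobalFunctions.

(** * The strong maximum principle *)

Section Laplacian.
Variables (R : realType) (m : nat) (U : set 'rV[R]_m) (oU : open U).
Variable g : 'rV[R]_m -> 'M[R]_m.
Hypothesis sg : forall i j, smooth U (fun x => g x i j).
Hypothesis gsym : forall x, U x -> (g x)^T = g x.
Hypothesis gpos : forall x, U x -> forall v : 'rV_m, v != 0 ->
  0 < dotv (v *m g x) v.
Implicit Types (u f : 'rV[R]_m -> R) (x v : 'rV[R]_m).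

Local Notation "'d_' i" := (dird (delta_mx 0 i : 'rV[R]_m))
  (at level 8, i at level 2, format "'d_' i").
Local Notation G x := (invmx (g x)).

Let sd f i : smooth U f -> smooth U (d_ i f).
Proof. exact: smooth_dird. Qed.

Let gU x : U x -> g x \in unitmx.
Proof. by move=> Ux; apply: posdef_unitmx; exact: gpos. Qed.

Let sG i j : smooth U (fun x => G x i j).
Proof. exact: (smooth_invmx oU sg gU). Qed.

Definition drift l x :=
  \sum_i (d_ i (fun y => G y i l) x + \sum_j christoffel g i i j x * G x j l).

Lemma smooth_partial i u : smooth U u -> smooth U (partial i u).
Proof. exact: smooth_derive. Qed.

Lemma smooth_christoffel k i j : smooth U (christoffel g k i j).
Proof.
apply: (smoothM oU (smooth_cst oU _)); apply: (smooth_sum oU) => l.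
apply: (smoothM oU) => //; apply: (smoothD oU); first apply: (smoothD oU).
- exact: smooth_partial (sg j l).
- exact: smooth_partial (sg i l).
- exact: (smoothN oU (smooth_partial l (sg i j))).
Qed.

Lemma smooth_drift l : smooth U (drift l).
Proof.
apply: (smooth_sum oU) => i; apply: (smoothD oU); first exact: sd.
by apply: (smooth_sum oU) => j; apply: (smoothM oU) => //; exact: smooth_christoffel.
Qed.

Lemma laplacianE u x : smooth U u -> U x ->
  laplacian g u x = \sum_i \sum_l G x i l * d_ i (d_ l u) x + \sum_l drift l x * d_ l u x.
Proof.
move=> su Ux.
have gradE y i : (gradient g u y) 0 i = \sum_l G y i l * d_ l u y.
  by rewrite mxE; apply: eq_bigr => l _; rewrite dirdE.
have sGu i l : smooth U (fun y => G y i l * d_ l u y).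
  exact: (smoothM oU (sG i l) (sd l su)).
have DG i l : d_ i (fun y => G y i l * d_ l u y) x =
    d_ i (fun y => G y i l) x * d_ l u x + G x i l * d_ i (d_ l u) x.
  exact: (dird_mul _ (sG i l) (sd l su) Ux).
transitivity (\sum_i (d_ i (fun y => \sum_l G y i l * d_ l u y) x +
    \sum_j christoffel g i i j x * \sum_l G x j l * d_ l u x)).
  apply: eq_bigr => i _; rewrite mxE dirdE; congr (_ + _).
    by congr (derive _ _ _); apply/funext => y; exact: gradE.
  by apply: eq_bigr => j _; rewrite gradE.
rewrite /drift; under [X in _ = _ + X]eq_bigr do rewrite mulr_suml.
rewrite [X in _ = _ + X]exchange_big -big_split; apply: eq_bigr => i _ /=.
have -> : d_ i (fun y => \sum_l G y i l * d_ l u y) x =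
    \sum_l (d_ i (fun y => G y i l) x * d_ l u x + G x i l * d_ i (d_ l u) x).
  by rewrite (dird_sum _ (sGu i) Ux); apply: eq_bigr => l _; exact: DG.
under [X in _ + X = _]eq_bigr do rewrite mulr_sumr.
rewrite [X in _ + X = _]exchange_big -!big_split; apply: eq_bigr => l _ /=.
rewrite mulrDl mulr_suml [X in X + _]addrC -addrA; congr (_ + (_ + _)).
by apply: eq_bigr => j _; rewrite mulrA.
Qed.

Lemma laplacianD u f (c : R) x : smooth U u -> smooth U f -> U x ->
  laplacian g (fun y => u y + c * f y) x = laplacian g u x + c * laplacian g f x.
Proof.
move=> su sf Ux.
have scf : smooth U (fun y => c * f y) := smoothM oU (smooth_cst oU c) sf.
have dE l y : U y -> d_ l (fun y => u y + c * f y) y = d_ l u y + c * d_ l f y.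
  move=> Uy; rewrite (dird_add _ su scf Uy) (dird_mul _ (smooth_cst oU c) sf Uy).
  by rewrite [dird _ (fun=> c) _]dirdE derive_const mul0r add0r.
have d2E i l : d_ i (d_ l (fun y => u y + c * f y)) x = d_ i (d_ l u) x + c * d_ i (d_ l f) x.
  have scdf : smooth U (fun y => c * d_ l f y) := smoothM oU (smooth_cst oU c) (sd l sf).
  rewrite (dird_ext oU _ (dE l) Ux) (dird_add _ (sd l su) scdf Ux).
  rewrite (dird_mul _ (smooth_cst oU c) (sd l sf) Ux).
  by rewrite [dird _ (fun=> c) _]dirdE derive_const mul0r add0r.
rewrite (laplacianE (smoothD oU su scf) Ux) (laplacianE su Ux) (laplacianE sf Ux).
rewrite mulrDr addrACA; congr (_ + _).
  rewrite mulr_sumr -big_split; apply: eq_bigr => i _ /=.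
  rewrite mulr_sumr -big_split; apply: eq_bigr => l _ /=.
  by rewrite d2E mulrDr (mulrCA c).
rewrite mulr_sumr -big_split; apply: eq_bigr => l _ /=.
by rewrite (dE l x Ux) mulrDr (mulrCA c).
Qed.

Lemma laplacian_sqr f x : smooth U f -> U x ->
  laplacian g (fun y => f y * f y) x =
    2 * f x * laplacian g f x + 2 * \sum_i \sum_l G x i l * (d_ i f x * d_ l f x).
Proof.
move=> sf Ux; have sff := smoothM oU sf sf.
have dE l y : U y -> d_ l (fun y => f y * f y) y = d_ l f y * f y + f y * d_ l f y.
  by move=> Uy; exact: (dird_mul _ sf sf Uy).
have d2E i l : d_ i (d_ l (fun y => f y * f y)) x =
    2 * f x * d_ i (d_ l f) x + 2 * (d_ i f x * d_ l f x).
  rewrite (dird_ext oU _ (dE l) Ux).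
  have s1 : smooth U (fun y => d_ l f y * f y) := smoothM oU (sd l sf) sf.
  have s2 : smooth U (fun y => f y * d_ l f y) := smoothM oU sf (sd l sf).
  rewrite (dird_add _ s1 s2 Ux) (dird_mul _ (sd l sf) sf Ux) (dird_mul _ sf (sd l sf) Ux).
  by move: (d_ i (d_ l f) x) (d_ i f x) (d_ l f x) (f x) => a b c d; ring.
rewrite (laplacianE sff Ux) (laplacianE sf Ux) mulrDr addrAC; congr (_ + _).
  rewrite !mulr_sumr -big_split; apply: eq_bigr => i _ /=.
  rewrite !mulr_sumr -big_split; apply: eq_bigr => l _ /=.
  rewrite d2E; move: (d_ i (d_ l f) x) (d_ i f x) (d_ l f x) (f x) (G x i l).
  by move=> a b c d e; ring.
rewrite mulr_sumr; apply: eq_bigr => l _ /=; rewrite (dE l x Ux).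
by move: (drift l x) (d_ l f x) (f x) => a b c; ring.
Qed.

(** In a basis that is orthonormal for [g x], the leading part is a sum of
    second derivatives along the basis vectors. *)
Lemma laplacian_at_max f x : smooth U f -> U x ->
  (\forall y \near x, f y <= f x) -> laplacian g f x <= 0.
Proof.
move=> sf Ux fmax.
have second v : 'D_v f x = 0 /\ 'D_v ('D_v f) x <= 0.
  apply: (second_derivative_at_max _ _ fmax).
    by apply: filterS (near_open oU Ux) => y; exact: smooth_differentiable.
  exact: smooth_differentiable (smooth_derive v sf) Ux.
have D2 v : 'D_v ('D_v f) x = \sum_i \sum_l v 0 i * v 0 l * d_ i (d_ l f) x.
  have DvE y : U y -> dird v f y = \sum_l v 0 l * d_ l f y.
    move=> Uy; rewrite dirdE (derive_row_expansion _ (smooth_differentiable sf Uy)).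
    by apply: eq_bigr => l _; rewrite dirdE.
  have -> : 'D_v ('D_v f) x = dird v (dird v f) x by rewrite unlock.
  rewrite (dird_ext oU _ DvE Ux) dirdE derive_row_expansion; last first.
    apply: differentiable_bigsum => l; apply: differentiableM.
      exact: differentiable_cst.
    exact: smooth_differentiable (sd l sf) Ux.
  apply: eq_bigr => i _.
  have svf l : smooth U (fun y => v 0 l * d_ l f y).
    exact: (smoothM oU (smooth_cst oU (v 0 l)) (sd l sf)).
  rewrite -dirdE (dird_sum _ svf Ux) scaler_sumr; apply: eq_bigr => l _.
  rewrite (dird_mul _ (smooth_cst oU (v 0 l)) (sd l sf) Ux) dirdE derive_const.
  by rewrite mul0r add0r /GRing.scale /= mulrA.
have [P [d [Pg _]]] := simultaneous_diagonalization (gsym Ux) (gsym Ux) (gpos Ux).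
have PPG : G x = P^T *m P.
  have E : P^T *m (P *m g x) = 1%:M by exact: mulmx1C.
  by rewrite -[LHS]mul1mx -E -!mulmxA mulmxV ?mulmx1//; exact: gU.
rewrite (laplacianE sf Ux) [X in _ + X]big1 ?addr0 => [|l _]; last first.
  by rewrite dirdE (second _).1 mulr0.
have -> : \sum_i \sum_l G x i l * d_ i (d_ l f) x = \sum_k 'D_(row k P) ('D_(row k P) f) x.
  under [RHS]eq_bigr do rewrite D2.
  rewrite [RHS]exchange_big; apply: eq_bigr => i _ /=.
  rewrite [RHS]exchange_big; apply: eq_bigr => l _ /=.
  by rewrite PPG mxE mulr_suml; apply: eq_bigr => k _; rewrite !mxE.
by apply: sumr_le0 => k _; exact: (second _).2.
Qed.

(** A minimum of [f] is a maximum of [- f], written here as [f - 2 f]. *)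
Lemma laplacian_at_min f x : smooth U f -> U x ->
  (\forall y \near x, f x <= f y) -> 0 <= laplacian g f x.
Proof.
move=> sf Ux fmin; rewrite -oppr_le0.
have -> : - laplacian g f x = laplacian g (fun y => f y + -2 * f y) x.
  by rewrite laplacianD//; ring.
apply: laplacian_at_max => //.
  exact: (smoothD oU sf (smoothM oU (smooth_cst oU (-2 : R)) sf)).
by apply: filterS fmin => y; lra.
Qed.

End Laplacian.

Section EuclideanBalls.
Variables (R : realType) (m : nat).
Implicit Types (x y c h : 'rV[R]_m).

Definition sqdist c x := dotv (x - c) (x - c).

Lemma norm_le_dotv h (r : R) : 0 <= r -> dotv h h <= r ^+ 2 -> `|h| <= r.
Proof.
move=> r0 hr; rewrite /Num.Def.normr /= mx_normrE; apply/bigmax_leP; split=> //=.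
move=> [i j] _ /=; rewrite -(@ler_pXn2r _ 2) ?nnegrE// real_normK ?num_real//.
apply: le_trans hr; rewrite dotvE (bigD1 j)//= ord1 -expr2 lerDl.
by rewrite sumr_ge0// => k _; rewrite -expr2 sqr_ge0.
Qed.

Lemma nbhs_euclidean_ball x (P : set 'rV[R]_m) : nbhs x P ->
  exists2 r : R, 0 < r & forall y, sqdist x y <= r ^+ 2 -> P y.
Proof.
move=> /nbhs_small_segment[d d0 dP]; exists (d / 2); first exact: divr_gt0.
move=> y yd; rewrite -[y](subrK x) addrC; apply: dP.
apply: le_lt_trans (norm_le_dotv _ yd) _; first by rewrite divr_ge0// ltW.
by rewrite ltr_pdivrMr// ltr_pMr// ltr1n.
Qed.

Lemma continuous_subc c (x : 'rV[R]_m) : {for x, continuous (fun y : 'rV[R]_m => y - c)}.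
Proof.
apply: (@continuousD _ _ _ (id : 'rV[R]_m -> 'rV[R]_m) (fun=> - c)).
  by move=> ?.
exact: cst_continuous.
Qed.

Lemma continuous_sqdist c (x : 'rV[R]_m) : {for x, continuous (sqdist c)}.
Proof. by apply: continuous_dotv; exact: continuous_subc. Qed.

Lemma closed_ball_compact c (r : R) : 0 <= r ->
  compact [set x | sqdist c x <= r ^+ 2].
Proof.
move=> r0; apply: bounded_closed_compact.
  exists (r + `|c|); split; first exact: num_real.
  move=> B rB x /= xr; apply: le_trans (ltW rB).
  rewrite -[x](subrK c); apply: le_trans (ler_normD _ _) _.
  by rewrite lerD2r norm_le_dotv.
apply: (@preimage_closed _ _ (sqdist c) [set z | z <= r ^+ 2]).
  by move=> x _; exact: continuous_sqdist.
exact: closed_le.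
Qed.

Lemma open_ball_open c (r : R) : open [set x | sqdist c x < r ^+ 2].
Proof.
apply: (@open_comp _ _ (sqdist c) [set z | z < r ^+ 2]); last exact: open_lt.
by move=> x _; exact: continuous_sqdist.
Qed.

Lemma sqdistC c x : sqdist c x = sqdist x c.
Proof. by rewrite /sqdist -opprB dotvNl dotvNr opprK. Qed.

Lemma sqdist_eq0 c x : (sqdist c x == 0) = (x == c).
Proof. by rewrite dotv_eq0 subr_eq0. Qed.

Lemma sqdistxx c : sqdist c c = 0.
Proof. by apply/eqP; rewrite sqdist_eq0. Qed.

Lemma sqdist_triangle c x y (r : R) :
  sqdist x y < r ^+ 2 -> sqdist y c < r ^+ 2 -> sqdist c x < (2 * r) ^+ 2.
Proof.
rewrite /sqdist => h1 h2.
have -> : x - c = - (y - x) + (y - c) by rewrite opprB addrA subrK.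
rewrite (_ : y - c = - (c - y)); last by rewrite opprB.
have := dotv_ge0 ((y - x) - (c - y)).
move: h1 h2; move: (y - x) (c - y) => a b h1 h2.
rewrite !(dotvDl, dotvDr, dotvNl, dotvNr) [dotv b a]dotvC.
rewrite exprMn; move: h1 h2; move: (dotv a a) (dotv a b) (dotv b b) (r ^+ 2) => p q s t.
by rewrite expr2 => h1 h2 h3; lra.
Qed.

Lemma smooth_gt_near (U : set 'rV[R]_m) (f : 'rV[R]_m -> R) x a :
  smooth U f -> U x -> a < f x -> \forall y \near x, a < f y.
Proof.
move=> sf Ux fx; have cf := differentiable_continuous (smooth_differentiable sf Ux).
exact: cvgr_gt cf a fx.
Qed.

Lemma smooth_id (U : set 'rV[R]_m) : open U -> smooth U (fun x => x).
Proof. by move=> oU; apply: smooth_row => // j; exact: smooth_coord. Qed.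

End EuclideanBalls.

Section StrongMaximum.
Variables (R : realType) (m : nat) (U : set 'rV[R]_m) (oU : open U).
Variable g : 'rV[R]_m -> 'M[R]_m.
Hypothesis sg : forall i j, smooth U (fun x => g x i j).
Hypothesis gsym : forall x, U x -> (g x)^T = g x.
Hypothesis gpos : forall x, U x -> forall v : 'rV_m, v != 0 ->
  0 < dotv (v *m g x) v.

Let gU x : U x -> g x \in unitmx.
Proof. by move=> Ux; apply: posdef_unitmx; exact: gpos. Qed.

Let sG i j : smooth U (fun x => invmx (g x) i j).
Proof. exact: (smooth_invmx oU sg gU). Qed.

Lemma smooth_laplacian f : smooth U f -> smooth U (laplacian g f).
Proof.
move=> sf; apply: (@smooth_ext _ _ _ oU _ (fun x =>
    \sum_i \sum_l invmx (g x) i l * dird (delta_mx 0 i) (dird (delta_mx 0 l) f) x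
      + \sum_l drift g l x * dird (delta_mx 0 l) f x)).
  by move=> x Ux; rewrite (laplacianE oU sg gpos sf Ux).
apply: (smoothD oU).
  apply: (smooth_sum oU) => i; apply: (smooth_sum oU) => l.
  by apply: (smoothM oU) => //; do 2!apply: smooth_dird.
apply: (smooth_sum oU) => l; apply: (smoothM oU); last exact: smooth_dird.
exact: (smooth_drift oU sg gpos).
Qed.

(** Hopf's barrier. If [s] vanishes at [p] with nonzero differential, then
    [s + beta s ^+ 2] has the sign of [s] and a positive Laplacian near [p],
    for large [beta]. *)
Lemma barrier (s : 'rV[R]_m -> R) (p e : 'rV[R]_m) :
  smooth U s -> U p -> s p = 0 -> e != 0 ->
  (forall i, dird (delta_mx 0 i) s p = e 0 i) ->
  exists v, [/\ smooth U v, v p = 0,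
    \forall x \near p, 0 < laplacian g v x &
    \forall x \near p, s x < 0 -> v x < 0].
Proof.
move=> ss Up sp0 e0 ds.
pose a x := \sum_i \sum_l invmx (g x) i l *
  (dird (delta_mx 0 i) s x * dird (delta_mx 0 l) s x).
pose c := laplacian g s.
have sc : smooth U c := smooth_laplacian ss.
have sa : smooth U a.
  apply: (smooth_sum oU) => i; apply: (smooth_sum oU) => l.
  apply: (smoothM oU) => //; apply: (smoothM oU); exact: smooth_dird.
have ap : 0 < a p.
  have -> : a p = dotv (e *m invmx (g p)) e.
    rewrite dotvE /a exchange_big; apply: eq_bigr => l _ /=.
    rewrite mxE mulr_suml; apply: eq_bigr => i _.
    by rewrite !ds mulrC -!mulrA [e 0 l * _]mulrC mulrA.
  have eE : e = e *m invmx (g p) *m g p by rewrite mulmxKV// gU.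
  rewrite [X in dotv _ X]eE dotvC; apply: gpos => //.
  by apply: contra_neq e0 => w0; rewrite eE w0 mul0mx.
pose beta := (`|c p| + 1) / a p.
have b0 : 0 < beta by rewrite divr_gt0// ltr_wpDl.
pose v x := s x + beta * (s x * s x).
have sss : smooth U (fun x => s x * s x) := smoothM oU ss ss.
have sv : smooth U v := smoothD oU ss (smoothM oU (smooth_cst oU beta) sss).
have LvE x : U x -> laplacian g v x = c x + beta * (2 * s x * c x + 2 * a x).
  move=> Ux; rewrite (laplacianD oU sg gpos beta ss sss Ux).
  by rewrite (laplacian_sqr oU sg gpos ss Ux).
exists v; split=> //.
- by rewrite /v sp0 mulr0 mulr0 addr0.
- have Lv0 : 0 < laplacian g v p.
    rewrite LvE// sp0 mulr0 mul0r add0r /beta.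
    have -> : (`|c p| + 1) / a p * (2 * a p) = 2 * (`|c p| + 1).
      by field; rewrite gt_eqF.
    by have := ler_norm (- c p); rewrite normrN; have := normr_ge0 (c p); lra.
  exact: smooth_gt_near (smooth_laplacian sv) Up Lv0.
- have s1 : smooth U (fun x => 1 + beta * s x).
    exact: (smoothD oU (smooth_cst oU (1 : R)) (smoothM oU (smooth_cst oU beta) ss)).
  have : 0 < 1 + beta * s p by rewrite sp0 mulr0 addr0.
  move=> /(smooth_gt_near s1 Up); apply: filterS => x x1 sx.
  rewrite /v (_ : _ + _ = s x * (1 + beta * s x)); last by ring.
  by rewrite pmulr_llt0.
Qed.

Lemma smooth_within_continuous (A : set 'rV[R]_m) (f : 'rV[R]_m -> R) :
  smooth U f -> A `<=` U -> {within A, continuous f}.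
Proof.
move=> sf AU; apply: continuous_in_subspaceT => x; rewrite inE => Ax.
exact: differentiable_continuous (smooth_differentiable sf (AU _ Ax)).
Qed.

(** Hopf: if [u] falls below its maximum at a point [q] close to [x0], let [p]
    be a point of the level set of the maximum that is nearest to [q]. A
    multiple of the barrier at [p], added to [u], produces an interior maximum
    with positive Laplacian. *)
Lemma strong_maximum (u : 'rV[R]_m -> R) x0 : smooth U u -> U x0 ->
  (forall x, U x -> laplacian g u x = 0) -> (forall x, U x -> u x <= u x0) ->
  \forall x \near x0, u x = u x0.
Proof.
move=> su Ux0 Lu umax.
have [r2 r20 r2U] := nbhs_euclidean_ball (near_open oU Ux0).
pose r := r2 / 2; have r0 : 0 < r by rewrite divr_gt0.
have rU x : sqdist x0 x <= (2 * r) ^+ 2 -> U x.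
  by rewrite /r mulrC divfK//; exact: r2U.
suff uE q : sqdist x0 q < r ^+ 2 -> u q = u x0.
  have : [set x | sqdist x0 x < r ^+ 2] x0 by rewrite /= sqdistxx exprn_gt0.
  by move=> /(near_open (@open_ball_open R m x0 r)); apply: filterS => x; exact: uE.
move=> xq; apply: contrapT => /eqP uq.
have r00 : 0 <= 2 * r by rewrite mulr_ge0// ltW.
pose B := [set x | sqdist x0 x <= (2 * r) ^+ 2].
pose S := [set x | B x /\ u x = u x0].
have cB : compact B := @closed_ball_compact R m x0 _ r00.
have clB : closed B by apply: compact_closed => //; exact: norm_hausdorff.
have clS : closed S.
  have -> : S = ~` (~` B `|` (U `&` [set x | u x != u x0])).
    apply/seteqP; split=> x.
      by move=> [Bx ux] [//|[_ /=]]; rewrite ux eqxx.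
    move=> /= h; have Bx : B x by apply: contrapT => nB; apply: h; left.
    by split=> //; apply: contrapT => /eqP nu; apply: h; right; split=> //; exact: rU.
  apply: open_closedC; apply: openU; first exact: closed_openC.
  rewrite openE => x [Ux /= ux]; apply: filterI; first exact: (near_open oU).
  have cu := differentiable_continuous (smooth_differentiable su Ux).
  have on : open_nbhs (u x) [set y : R | y != u x0].
    by split; [exact: open_neq|exact: ux].
  exact: (cu _ (open_nbhs_nbhs on)).
have cS : compact S by apply: subclosed_compact clS cB _ => x [].
have Sx0 : S x0 by split=> //; rewrite /B /= sqdistxx exprn_ge0.
have [||p] := @EVT_min_rV R _ (sqdist q) S _ cS.
- by exists x0.
- by apply: continuous_in_subspaceT => x _; exact: continuous_sqdist.
rewrite inE => -[Bp up] pmin.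
have pq : sqdist q p < r ^+ 2.
  by apply: le_lt_trans (pmin x0 _) _; rewrite ?inE// sqdistC.
have Bp' : sqdist x0 p < (2 * r) ^+ 2.
  by apply: (@sqdist_triangle _ _ _ _ q); rewrite sqdistC.
have Up : U p := rU _ Bp.
pose e := q - p.
have e0 : e != 0 by rewrite subr_eq0; apply: contra_neq uq => ->.
pose s x := dotv (x - p) e - dotv (x - p) (x - p).
have sneg x : B x -> u x = u x0 -> x != p -> s x < 0.
  move=> Bx ux xp.
  have := pmin x; rewrite inE => /(_ (conj Bx ux)).
  rewrite /sqdist (_ : p - q = - e); last by rewrite opprB.
  rewrite (_ : x - q = (x - p) - e); last by rewrite opprB addrA subrK.
  have : 0 < dotv (x - p) (x - p) by rewrite dotv_gt0// subr_eq0.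
  rewrite /s; move: (x - p) (e) => y e'.
  rewrite !(dotvDl, dotvDr, dotvNl, dotvNr) [dotv e' y]dotvC.
  by move: (dotv y y) (dotv y e') (dotv e' e') => a b c; lra.
have sxp : smooth U (fun x => x - p) := smoothD oU (smooth_id oU) (smooth_cst oU (- p)).
have sxe : smooth U (fun x => dotv (x - p) e) := smooth_dotv oU sxp (smooth_cst oU e).
have sxx : smooth U (fun x => dotv (x - p) (x - p)) := smooth_dotv oU sxp sxp.
have ss : smooth U s := smoothD oU sxe (smoothN oU sxx).
have ds i : dird (delta_mx 0 i) s p = e 0 i.
  have dxp : dird (delta_mx 0 i) (fun x => x - p) p = delta_mx 0 i :> 'rV[R]_m.
    rewrite (dird_add _ (smooth_id oU) (smooth_cst oU (- p)) Up) !dirdE.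
    by rewrite derive_const addr0 derive_id.
  rewrite (dird_add _ sxe (smoothN oU sxx) Up).
  rewrite (dird_dotv _ sxp (smooth_cst oU e) Up) dxp [dird _ (fun=> e) _]dirdE.
  rewrite derive_const subrr dotv0l addr0 dirdE deriveN; last first.
    by apply: diff_derivable; exact: smooth_differentiable sxx Up.
  rewrite -dirdE (dird_dotv _ sxp sxp Up) subrr dotv0l dotv0r !addr0 oppr0 addr0.
  by rewrite /dotv -rowE !mxE.
have sp0 : s p = 0 by rewrite /s subrr !dotv0l subrr.
have [v [sv vp0 Lvpos vneg]] := barrier ss Up sp0 e0 ds.
have [d d0 dP] := nbhs_euclidean_ball
  (filterI (filterI Lvpos vneg) (near_open (@open_ball_open R m x0 (2 * r)) Bp')).
pose W := [set x | sqdist p x <= d ^+ 2].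
have WB x : W x -> B x by move=> /dP[_ /ltW].
have WU x : W x -> U x by move=> /WB; exact: rU.
have cW : compact W := @closed_ball_compact R m p _ (ltW d0).
pose dW := [set x | sqdist p x = d ^+ 2].
have dWW x : dW x -> W x by rewrite /W /dW /= => ->.
have dWp x : dW x -> x != p.
  by rewrite /dW /= => xd; rewrite -(sqdist_eq0 p) xd gt_eqF// exprn_gt0.
have [eps eps0 epsP] : exists2 eps : R, 0 < eps & forall x, dW x -> u x + eps * v x < u x0.
  pose C := [set x | dW x /\ 0 <= s x].
  have neg x eps : dW x -> ~ C x -> 0 < eps -> u x + eps * v x < u x0.
    move=> dWx nCx eps0; have sx : s x < 0.
      by rewrite ltNge; apply/negP => s0; apply: nCx.
    have [[_ /(_ sx) vx] _] := dP _ (dWW _ dWx).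
    by rewrite -[ltRHS]addr0 ler_ltD ?umax ?pmulr_rlt0//; exact: WU _ (dWW _ dWx).
  have [C0|nC] := pselect (C !=set0); last first.
    by exists 1 => // x dWx; apply: neg => // Cx; apply: nC; exists x.
  have csq (x : 'rV[R]_m) : {for x, continuous s}.
    apply: (@continuousB _ _ _ (fun x : 'rV[R]_m => dotv (x - p) e)).
      by apply: continuous_dotv; [exact: continuous_subc|exact: cst_continuous].
    by apply: continuous_dotv; exact: continuous_subc.
  have cC : compact C.
    apply: subclosed_compact cW _ => [|x [/dWW]//].
    apply: closedI.
      apply: (@preimage_closed _ _ (sqdist p) [set d ^+ 2]); last exact: closed_eq.
      by move=> x _; exact: continuous_sqdist.
    apply: (@preimage_closed _ _ s [set z | 0 <= z]); last exact: closed_ge.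
    by move=> x _; exact: csq.
  have CU : C `<=` U by move=> x [/dWW/WU].
  have [c1] := EVT_max_rV C0 cC (smooth_within_continuous su CU).
  rewrite inE => Cc1 c1max.
  have [c2] := EVT_max_rV C0 cC (smooth_within_continuous sv CU).
  rewrite inE => Cc2 c2max.
  have uc1 : u c1 < u x0.
    rewrite lt_neqAle umax ?andbT; last exact: CU.
    case: (Cc1) => dc1; rewrite leNgt => /negP sc1; apply/eqP => uc1.
    by apply: sc1; apply: sneg => //; [exact: WB _ (dWW _ dc1)|exact: dWp].
  pose eps := (u x0 - u c1) / (2 * (1 + `|v c2|)).
  have n0 : 0 < 1 + `|v c2| by rewrite ltr_pwDl.
  have eps0 : 0 < eps by rewrite divr_gt0 ?subr_gt0// mulr_gt0.
  exists eps => // x dWx; have [Cx|nCx] := pselect (C x); last exact: neg.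
  have h1 : u x <= u c1 by apply: c1max; rewrite inE.
  have h2 : eps * v x <= eps * (1 + `|v c2|).
    rewrite ler_pM2l//; apply: le_trans (c2max x _) _; first by rewrite inE.
    by rewrite (le_trans (ler_norm _))// lerDr.
  have h3 : eps * (1 + `|v c2|) = (u x0 - u c1) / 2 by rewrite /eps; field; rewrite gt_eqF.
  rewrite h3 in h2; apply: le_lt_trans (lerD h1 h2) _.
  by move: uc1; move: (u c1) (u x0) => t t' tt'; lra.
pose w x := u x + eps * v x.
have sw : smooth U w := smoothD oU su (smoothM oU (smooth_cst oU eps) sv).
have Wp : W p by rewrite /W /= sqdistxx exprn_ge0// ltW.
have [||z] := @EVT_max_rV R _ w W _ cW.
- by exists p.
- exact: smooth_within_continuous.
rewrite inE => Wz zmax.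
have wz : u x0 <= w z.
  by apply: le_trans (zmax p _); rewrite ?inE// /w vp0 mulr0 addr0 up.
have zin : sqdist p z < d ^+ 2.
  rewrite lt_neqAle (Wz : sqdist p z <= d ^+ 2) andbT; apply/eqP => zd.
  by move: wz; rewrite leNgt epsP.
have Lw : laplacian g w z <= 0.
  apply: (laplacian_at_max oU sg gsym gpos sw (WU _ Wz)).
  have := near_open (@open_ball_open R m p d) zin; apply: filterS => y /= /ltW yd.
  by apply: zmax; rewrite inE.
move: Lw; rewrite (laplacianD oU sg gpos eps su sv (WU _ Wz)) Lu ?add0r; last exact: WU.
by rewrite pmulr_rle0// leNgt; have [[-> _] _] := dP _ Wz.
Qed.

End StrongMaximum.

(** * Hyperovaloids *)

Lemma constant_near (R : realType) (V : normedModType R) n (U : set V)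
    (F : V -> 'rV[R]_n) x : open U -> smooth U F ->
  (forall y v, U y -> 'D_v F y = 0) -> U x -> \forall y \near x, F y = F x.
Proof.
move=> oU sF dF Ux; have [d d0 dU] := nbhs_small_segment (near_open oU Ux).
apply/nbhs_ballP; exists d => // y; rewrite -ball_normE /= => xy.
pose v := y - x.
have vd : `|v| < d by rewrite distrC.
apply/rowP => j; have sFj := smooth_entry oU 0 j sF.
have Us (s : R) : 0 <= s <= 1 -> U (x + s *: v).
  move=> /andP[s0 s1]; apply: dU; rewrite normrZ ger0_norm//.
  by rewrite (le_lt_trans _ vd)// ler_piMl.
have [s hs|s /andP[s0 s1]] := @line_MVT R V (fun z => F z 0 j) x v 1 ltr01.
  exact: smooth_differentiable sFj (Us _ hs).
have Uxs : U (x + s *: v) by apply: Us; rewrite !ltW.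
rewrite derive_coord; last exact: smooth_differentiable sF Uxs.
rewrite dF// mxE mulr0 scale1r => /eqP; rewrite subr_eq0 => /eqP.
by rewrite (addrC x) subrK.
Qed.

Section Hyperovaloid.
Variables (R : realType) (m : nat).
Variables (M : set 'rV[R]_m.+1) (N : 'rV[R]_m.+1 -> 'rV[R]_m.+1).
Hypotheses (uN : unit_normal_field M N) (conv : locally_strongly_convex M N).
Implicit Types (x y v : 'rV[R]_m).

Section OneChart.
Variables (U : set 'rV[R]_m) (X : 'rV[R]_m -> 'rV[R]_m.+1).
Hypothesis cX : local_parametrization M U X.
Local Notation S := (shape_operator N X).
Local Notation h := (second_fundamental_form N X).
Local Notation g := (gram X).

Let oU : open U := chart_open cX.
Let sX := chart_smooth cX.
Let sN := chart_normal_smooth uN cX.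
Let fX := chart_free cX.
Let n1 := chart_normal1 uN cX.
Let n0 x v (Ux : U x) := chart_normal0 uN cX v Ux.

Lemma second_fundamental_formE x : h x = S x *m g x.
Proof. by apply/matrixP => i j; rewrite [LHS]mxE /gram mulmxA mulmx_trE [in RHS]row_mul. Qed.

Lemma second_fundamental_form_sym x : U x -> (h x)^T = h x.
Proof.
move=> Ux; have E := shape_gram_sym oU sX sN fX n1 n0 Ux.
by rewrite second_fundamental_formE; exact: E.
Qed.

Lemma second_fundamental_form_pos x : U x -> forall v : 'rV_m, v != 0 ->
  0 < dotv (v *m h x) v.
Proof. by move=> Ux v; exact: (conv cX Ux). Qed.

Lemma smooth_second_fundamental_form i j : smooth U (fun x => h x i j).
Proof.
apply: (@smooth_ext _ _ _ oU _ (fun x => (S x *m g x) i j)).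
  by move=> x _; rewrite second_fundamental_formE.
exact: (smooth_shape_gram oU sX sN fX n1 n0).
Qed.

Lemma smooth_shape_operator i j : smooth U (fun x => S x i j).
Proof. exact: (smooth_shape oU sX sN fX n1 n0). Qed.

(** In a basis that is orthonormal for the first fundamental form and diagonal
    for the second one, the shape operator is diagonal. *)
Lemma principal_curvatures x : U x -> exists d : 'I_m -> R,
  [/\ forall i, 0 < d i, \det (S x) = \prod_i d i, \tr (S x) = \sum_i d i &
    forall mu, (forall i, d i = mu) -> S x = mu%:M].
Proof.
move=> Ux.
have [P [d [Pg Ph]]] := simultaneous_diagonalization (gram_sym ('J X x))
  (second_fundamental_form_sym Ux) (gram_posdef (fX Ux)).
rewrite -/(gram X x) in Pg; rewrite second_fundamental_formE in Ph.
have uP : P \in unitmx.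
  by have /mulmx1_unit[] : P *m (g x *m P^T) = 1%:M by rewrite mulmxA.
have := second_fundamental_form_pos Ux; rewrite second_fundamental_formE.
move: Ph; move: (S x) => A Ph hpos.
have PS : P *m A *m invmx P = diag_mx d.
  by rewrite -[LHS]mulmx1 -Pg -Ph -!mulmxA mulKmx.
have SE : A = invmx P *m diag_mx d *m P.
  by rewrite -PS !mulmxA mulVmx// mul1mx -mulmxA mulVmx// mulmx1.
exists (d 0); split.
- move=> i; have rP : row i P != 0.
    apply/eqP => Pi; have := congr1 (row i) Pg.
    rewrite -mulmxA row_mul Pi mul0mx => /rowP/(_ i); rewrite !mxE eqxx => /eqP.
    by rewrite eq_sym oner_eq0.
  have := hpos _ rP.
  by rewrite -row_mul -mulmx_trE Ph mxE eqxx mulr1n.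
- rewrite SE !det_mulmx det_inv det_diag mulrAC mulVf ?mul1r//.
  by move: uP; rewrite unitmxE unitfE.
- by rewrite SE mxtrace_mulC mulmxA mulmxV// mul1mx mxtrace_diag.
- move=> mu dmu; rewrite SE (_ : diag_mx d = mu%:M).
    by rewrite mul_mx_scalar -scalemxAl mulVmx// scalemx1.
  by apply/matrixP => i j; rewrite !mxE dmu.
Qed.

Lemma det_shape_gt0 x : U x -> 0 < \det (S x).
Proof.
move=> Ux; have [d [d0 -> _ _]] := principal_curvatures Ux.
by apply: prodr_gt0 => i _; exact: d0.
Qed.

Lemma mean_curvature_gt0 x : (0 < m)%N -> U x -> 0 < mean_curvature N X x.
Proof.
move=> m0 Ux; rewrite /mean_curvature mulr_gt0 ?invr_gt0 ?ltr0n//.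
have [d [d0 _ -> _]] := principal_curvatures Ux.
rewrite (bigD1 (Ordinal m0))//= ltr_pwDl// sumr_ge0// => i _; exact: ltW.
Qed.

Definition log_det y := ln (\det (S y)).

Lemma smooth_det_shape : smooth U (fun y => \det (S y)).
Proof. exact: (smooth_determinant oU smooth_shape_operator). Qed.

Lemma smooth_log_det : smooth U log_det.
Proof. by apply: (smooth_ln oU _ smooth_det_shape) => x; exact: det_shape_gt0. Qed.

Lemma log_det_le x y : U x -> U y -> (log_det x <= log_det y) = (\det (S x) <= \det (S y)).
Proof. by move=> Ux Uy; rewrite ler_ln ?posrE ?det_shape_gt0. Qed.

End OneChart.

Hypotheses (m0 : (0 < m)%N) (hM : hypersurface M) (cM : compact M).

Let cdet U X x : local_parametrization M U X -> U x ->
  {for x, continuous (fun y => \det (shape_operator N X y))}.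
Proof.
move=> cX Ux.
exact: differentiable_continuous (smooth_differentiable (smooth_det_shape cX) Ux).
Qed.

(** At a maximum of [\det A] the Laplacian of its logarithm is nonpositive and
    at a minimum it is nonnegative, so that [F] vanishes on all values of
    [\det A]. The logarithm is then harmonic, and the set where it attains its
    maximum is open and closed. *)
Lemma det_shape_constant (F : R -> R) : {homo F : s t / s <= t} ->
  (forall U X x, local_parametrization M U X -> U x -> exists2 w, 0 < w &
     laplacian (second_fundamental_form N X) (log_det X) x
       = w * F (\det (shape_operator N X x))) ->
  exists K, forall U X x, local_parametrization M U X -> U x ->
    \det (shape_operator N X x) = K.
Proof.
move=> Fmono lapE.
have [U1 [X1 [x1 [c1 Ux1 max1]]]] := @chart_max _ _ _ hM cM
  (fun X x => \det (shape_operator N X x)) (det_invariant uN) cdet.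
have [|U2 [X2 [x2 [c2 Ux2 max2]]]] := @chart_max _ _ _ hM cM
  (fun X x => - \det (shape_operator N X x)) _
  (fun U X x cX Ux => @continuousN _ _ _ _ _ (cdet cX Ux)).
  move=> U X x V Y y cX cY Ux Vy XY.
  exact: (congr1 (fun z => - z) (det_invariant uN cX cY Ux Vy XY)).
have F1 : F (\det (shape_operator N X1 x1)) <= 0.
  have [w w0 E] := lapE _ _ _ c1 Ux1.
  rewrite -(pmulr_rle0 _ w0) -E; apply: (laplacian_at_max (chart_open c1)
    (smooth_second_fundamental_form c1) (second_fundamental_form_sym c1)
    (second_fundamental_form_pos c1) (smooth_log_det c1) Ux1).
  apply: filterS (near_open (chart_open c1) Ux1) => y Uy.
  by rewrite (log_det_le c1 Uy Ux1); exact: max1 c1 Uy.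
have F2 : 0 <= F (\det (shape_operator N X2 x2)).
  have [w w0 E] := lapE _ _ _ c2 Ux2.
  rewrite -(pmulr_rge0 _ w0) -E; apply: (laplacian_at_min (chart_open c2)
    (smooth_second_fundamental_form c2) (second_fundamental_form_sym c2)
    (second_fundamental_form_pos c2) (smooth_log_det c2) Ux2).
  apply: filterS (near_open (chart_open c2) Ux2) => y Uy.
  by rewrite (log_det_le c2 Ux2 Uy) -lerN2; exact: max2 c2 Uy.
have lap0 U X x : local_parametrization M U X -> U x ->
    laplacian (second_fundamental_form N X) (log_det X) x = 0.
  move=> cX Ux; have [w w0 ->] := lapE _ _ _ cX Ux.
  suff -> : F (\det (shape_operator N X x)) = 0 by rewrite mulr0.
  apply/eqP; rewrite eq_le; apply/andP; split.
    by apply: le_trans (Fmono _ _ _) F1; exact: max1 cX Ux.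
  by apply: le_trans F2 (Fmono _ _ _); rewrite -lerN2; exact: max2 cX Ux.
pose K := \det (shape_operator N X1 x1).
pose P := [set p | forall U X x, local_parametrization M U X -> U x -> X x = p ->
  \det (shape_operator N X x) = K].
have PE U X x : local_parametrization M U X -> U x ->
    P (X x) <-> \det (shape_operator N X x) = K.
  move=> cX Ux; split=> [/(_ _ _ _ cX Ux erefl)//|E V Y y cY Vy YX].
  exact: (etrans (det_invariant uN cY cX Vy Ux YX) E).
have PM : forall p, M p -> P p.
  apply: (chart_connected hM).
  - move=> U X x cX Ux /(PE _ _ _ cX Ux) EK.
    have lmax y : U y -> log_det X y <= log_det X x.
      move=> Uy; have Kx : K <= \det (shape_operator N X x) by rewrite EK.
      by rewrite (log_det_le cX Uy Ux); exact: (le_trans (max1 _ _ _ cX Uy) Kx).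
    have near_eq := strong_maximum (chart_open cX) (smooth_second_fundamental_form cX)
      (second_fundamental_form_sym cX) (second_fundamental_form_pos cX)
      (smooth_log_det cX) Ux (fun y => @lap0 _ _ y cX) lmax.
    apply: filterS2 near_eq (near_open (chart_open cX) Ux) => y ly Uy.
    apply/(PE _ _ _ cX Uy); rewrite -EK; apply: ln_inj; rewrite ?posrE.
    + exact: (det_shape_gt0 cX Uy).
    + exact: (det_shape_gt0 cX Ux).
    + exact: ly.
  - move=> U X x cX Ux nP.
    have nK : \det (shape_operator N X x) != K.
      by apply/eqP => E; apply: nP; apply/(PE _ _ _ cX Ux).
    have on : open_nbhs (\det (shape_operator N X x)) [set y : R | y != K].
      by split; [exact: open_neq|exact: nK].
    have nn : \forall y \near x, \det (shape_operator N X y) != K.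
      exact: (cdet cX Ux (open_nbhs_nbhs on)).
    apply: filterS2 nn (near_open (chart_open cX) Ux) => y /eqP yK Uy.
    by move=> /(PE _ _ _ cX Uy).
  - by exists (X1 x1); [apply: (chart_in c1)|apply/(PE _ _ _ c1 Ux1)].
exists K => U X x cX Ux.
by apply/(PE _ _ _ cX Ux); apply: PM; apply: (chart_in cX).
Qed.

(** The point where the trace is maximal is umbilic; there the trace equals the
    lower bound given by the inequality of the means for the constant
    determinant, hence equality holds at all points. *)
Lemma constant_det_umbilic K :
  (forall U X x, local_parametrization M U X -> U x ->
    \det (shape_operator N X x) = K) ->
  exists2 mu, 0 < mu & forall U X x, local_parametrization M U X -> U x ->
    shape_operator N X x = mu%:M.
Proof.
move=> detK.
have [|U [X [x [cX Ux trmax]]]] := @chart_max _ _ _ hM cM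
  (fun X x => \tr (shape_operator N X x)) (trace_invariant uN).
  move=> U X x cX Ux.
  have str := smooth_trace (chart_open cX) (smooth_shape_operator cX).
  exact: differentiable_continuous (smooth_differentiable str Ux).
have [mu muE] : exists mu, shape_operator N X x = mu%:M.
  apply: (shape_scalar_at_max (chart_open cX) Ux (chart_smooth cX)
    (chart_normal_smooth uN cX) (chart_free cX) (chart_normal1 uN cX)
    (fun x v Ux => chart_normal0 uN cX v Ux)).
  - move=> v v0; have := second_fundamental_form_pos cX Ux v0.
    by rewrite second_fundamental_formE.
  - by move=> y Uy; exact: detK cX Uy.
  - by move=> y Uy; exact: trmax cX Uy.
have muK : K = mu ^+ m by rewrite -(detK _ _ _ cX Ux) muE det_scalar.
have mtr : \tr (shape_operator N X x) = mu *+ m by rewrite muE mxtrace_scalar.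
have mR : 0 < m%:R :> R by rewrite ltr0n.
have mu0 : 0 < mu.
  have [d [d0 _ dtr _]] := principal_curvatures cX Ux.
  have : 0 < mu *+ m.
    rewrite -mtr dtr (bigD1 (Ordinal m0))//= ltr_pwDl// sumr_ge0// => i _; exact: ltW.
  by rewrite pmulrn_lgt0.
exists mu; first exact: mu0.
move=> V Y y cY Vy.
have [d [d0 dK dtr dmu]] := principal_curvatures cY Vy.
apply: dmu.
have sle : \sum_i d i <= mu *+ m by rewrite -dtr -mtr; exact: trmax cY Vy.
have pE : \prod_i d i = mu ^+ m by rewrite -dK (detK _ _ _ cY Vy).
have [agm agmE] := @leif_AGM R _ [set: 'I_m]%SET d (fun i _ => ltW (d0 i)).
rewrite cardsT card_ord in agm agmE.
have sumE : \sum_(i in [set: 'I_m]%SET) d i = \sum_i d i.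
  by apply: eq_bigl => i; rewrite inE.
have prodE : \prod_(i in [set: 'I_m]%SET) d i = \prod_i d i.
  by apply: eq_bigl => i; rewrite inE.
rewrite sumE prodE pE in agm agmE.
have S0 : 0 <= \sum_i d i by rewrite sumr_ge0// => i _; exact: ltW.
have meanle : (\sum_i d i) / m%:R <= mu.
  by rewrite ler_pdivrMr// mulr_natr.
have meanE : (\sum_i d i) / m%:R = mu.
  apply/eqP; rewrite eq_le meanle /=.
  rewrite -(@ler_pXn2r _ m) ?nnegrE ?(ltW mu0)//.
  by rewrite divr_ge0// ler0n.
move: agmE; rewrite meanE eqxx => /esym/forall_inP alleq i.
have dd j : d j = d i.
  by have /forall_inP/(_ i (finset.in_setT i))/eqP := alleq j (finset.in_setT j).
have : \sum_j d j = d i *+ m by rewrite (eq_bigr (fun=> d i)) ?sumr_const ?card_ord.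
by move: meanE => /[swap] -> <-; rewrite -[d i *+ m]mulr_natr mulfK// gt_eqF.
Qed.

(** With [A = mu I], the vector [N + mu p] is constant, and so [M] lies on a
    sphere. All of the sphere is reached: in the direction [a] of any of its
    points, the height function has a maximum on [M], at which [N] is parallel
    to [a]. *)
Lemma umbilic_hypersphere mu : 0 < mu ->
  (forall U X x, local_parametrization M U X -> U x ->
    shape_operator N X x = mu%:M) -> hypersphere M.
Proof.
move=> mu0 umb; have [[p0 Mp0] _ charts] := hM.
have ZC U X x : local_parametrization M U X -> U x ->
    \forall y \near x, N (X y) + mu *: X y = N (X x) + mu *: X x.
  move=> cX Ux.
  have sX := chart_smooth cX; have sN := chart_normal_smooth uN cX.
  have smX : smooth U (fun y => mu *: X y).
    exact: (smooth_scale (chart_open cX) (smooth_cst (chart_open cX) mu) sX).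
  apply: (constant_near (chart_open cX) (smoothD (chart_open cX) sN smX)) => //.
  move=> y v Uy.
  have dX := smooth_differentiable sX Uy; have dN := smooth_differentiable sN Uy.
  rewrite (derive_add v dN (smooth_differentiable smX Uy)) (deriveZ mu (diff_derivable dX)).
  rewrite (deriveEjacobian v dX) (deriveEjacobian v dN).
  have : shape_operator N X y *m 'J X y = - 'J (N \o X) y.
    exact: (shape_jacobian (chart_open cX) sN (chart_free cX)
      (chart_normal1 uN cX) (fun x v Ux => chart_normal0 uN cX v Ux) Uy).
  rewrite (umb _ _ _ cX Uy) mul_scalar_mx => E.
  by rewrite scalemxAr E mulmxN addrN.
pose z0 := N p0 + mu *: p0.
have Zz0 : forall p, M p -> N p + mu *: p = z0.
  apply: (chart_connected hM (P := [set p | N p + mu *: p = z0])).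
  - by move=> U X x cX Ux /= <-; exact: (ZC _ _ _ cX Ux).
  - move=> U X x cX Ux /= nz; have := ZC _ _ _ cX Ux.
    by apply: filterS => y ->.
  - by exists p0.
pose c := mu^-1 *: z0.
have pc p : M p -> p - c = - (mu^-1 *: N p).
  move=> Mp; rewrite /c -(Zz0 p Mp) scalerDr scalerA mulVf ?gt_eqF// scale1r.
  by rewrite opprD addrCA subrr addr0.
have N1 p : M p -> dotv (N p) (N p) = 1.
  by move=> /charts[U [X [cX [x Ux <-]]]]; exact: (chart_normal1 uN cX Ux).
have imu0 : 0 < mu^-1 by rewrite invr_gt0.
have MS p : M p -> dotv (p - c) (p - c) = mu^-1 ^+ 2.
  by move=> Mp; rewrite pc// dotvNl dotvNr opprK dotvZl dotvZr N1// mulr1.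
exists c, mu^-1; split=> //; apply/seteqP; split=> q; first exact: MS.
move=> /= qS; pose a := q - c.
have [||U [X [x [cX Ux amax]]]] := @chart_max _ _ _ hM cM (fun X x => dotv (X x) a).
- by move=> U X x V Y y _ _ _ _ ->.
- move=> U X x cX Ux; apply: continuous_dotv; last exact: cst_continuous.
  exact: (differentiable_continuous (smooth_differentiable (chart_smooth cX) Ux)).
have dX := smooth_differentiable (chart_smooth cX) Ux.
have oU := chart_open cX.
pose p := X x; have Mp : M p := chart_in cX Ux.
have crit v : dotv (v *m 'J X x) a = 0.
  have sXa := smooth_dotv oU (chart_smooth cX) (smooth_cst oU a).
  have [|||+ _] := @second_derivative_at_max _ _ (fun y => dotv (X y) a) x v.
  - by apply: filterS (near_open oU Ux) => y; exact: smooth_differentiable.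
  - exact: (smooth_differentiable (smooth_derive v sXa) Ux).
  - by apply: filterS (near_open oU Ux) => y Uy; exact: amax cX Uy.
  rewrite (derive_dotv v dX (differentiable_cst a x)) derive_const dotv0r addr0.
  by rewrite (deriveEjacobian v dX).
have aN : a = dotv a (N p) *: N p.
  apply/eqP; rewrite -subr_eq0 -dotv_eq0; apply/eqP.
  set w := a - _.
  have wN : dotv w (N p) = 0.
    by rewrite /w dotvDl dotvNl dotvZl N1// mulr1 subrr.
  have /submxP[v wE] : (w <= 'J X x)%MS.
    exact: (tangentP (chart_free cX) (chart_normal1 uN cX)
      (fun x v Ux => chart_normal0 uN cX v Ux) Ux wN).
  rewrite {2}/w dotvDr dotvNr dotvZr wN mulr0 subr0 wE; exact: crit.
have t2 : dotv a (N p) ^+ 2 = mu^-1 ^+ 2.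
  by rewrite -qS -/a {2 3}aN dotvZl dotvZr N1// mulr1 expr2.
have := t2 => /eqP; rewrite eqf_sqr => /orP[] /eqP t; last first.
  have E : a = p - c by rewrite pc// aN t scaleNr.
  by rewrite -(subrK c q) -/a E subrK.
(* otherwise [M] is the single point opposite to [q] *)
have ac : a = - (p - c) by rewrite pc// opprK -t -aN.
have Msingle p' : M p' -> p' = p.
  move=> Mp'; have [V [Y [cY [y Vy Yp']]]] := charts p' Mp'.
  have := amax _ _ _ cY Vy; rewrite Yp' -/p.
  have E1 := MS _ Mp'; have E2 := MS _ Mp.
  move=> le; have {}le : dotv (p' - c) a <= dotv (p - c) a by rewrite !dotvDl lerD2r.
  rewrite ac !dotvNr lerN2 E2 in le.
  rewrite -[LHS](subrK c) -[RHS](subrK c).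
  move: E1 E2 le; move: (p' - c) (p - c) => b b' E1 E2 le.
  congr (_ + _); apply/eqP; rewrite -subr_eq0 -dotv_eq0 eq_le dotv_ge0 andbT.
  rewrite dotvDl dotvNl !dotvDr !dotvNr E1 E2 [dotv b' b]dotvC.
  by move: (dotv b b') (mu^-1 ^+ 2) le => b1 b2 le; lra.
exfalso.
have [d d0 dU] := nbhs_small_segment (near_open oU Ux).
pose e : 'rV[R]_m := delta_mx 0 (Ordinal m0).
have [s s0 se] := small_multiple e d0.
have Uy := dU _ se.
have XE : X (x + s *: e) = X x by rewrite (Msingle _ (chart_in cX Uy)).
have : x + s *: e = x.
  by case: cX => _ _ _ inj _; apply: inj; rewrite ?inE.
move/eqP; rewrite -subr_eq0 addrAC subrr add0r scaler_eq0 gt_eqF//= => /eqP.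
by move=> /matrixP/(_ 0 (Ordinal m0)); rewrite !mxE !eqxx => /eqP; rewrite oner_eq0.
Qed.

End Hyperovaloid.


Theorem theorem6 (R : realType) (m : nat) (m_ge1 : (1 <= m)%N)
    (M : set 'rV[R]_m.+1) (N : 'rV[R]_m.+1 -> 'rV[R]_m.+1)
    (hM : hyperovaloid M N)
    (f : R -> R) (f_incr : {homo f : x y / x <= y})
    (hf :
      (forall U X x, local_parametrization M U X -> U x ->
         mean_curvature_II N X x =
           m%:R / 2 * mean_curvature N X x + f (\det (shape_operator N X x)))
      \/
      (forall U X x, local_parametrization M U X -> U x ->
         mean_curvature_II N X x =
           mean_curvature N X x * f (\det (shape_operator N X x)))) :
  hypersphere M.
Proof.
have [hyp cM uN conv] := hM.
have IIE X x : mean_curvature_II N X x = m%:R / 2 * mean_curvature N X x +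
    4^-1 * laplacian (second_fundamental_form N X) (log_det N X) x by [].
suff [K detK] : exists K, forall U X x, local_parametrization M U X -> U x ->
    \det (shape_operator N X x) = K.
  have [mu mu0 umb] := constant_det_umbilic uN conv m_ge1 hyp cM detK.
  exact: (umbilic_hypersphere uN m_ge1 hyp cM mu0 umb).
case: hf => hf.
- apply: (det_shape_constant uN conv hyp cM f_incr) => U X x cX Ux.
  exists 4 => //; have := hf _ _ _ cX Ux; rewrite IIE => /addrI <-.
  by rewrite mulrA divff ?mul1r// pnatr_eq0.
- have F_incr : {homo (fun t => f t - m%:R / 2) : s t / s <= t}.
    by move=> s t st; rewrite lerD2r f_incr.
  apply: (det_shape_constant uN conv hyp cM F_incr) => U X x cX Ux.
  have H0 := mean_curvature_gt0 uN conv cX m_ge1 Ux.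
  exists (4 * mean_curvature N X x); first by rewrite mulr_gt0.
  have := hf _ _ _ cX Ux; rewrite IIE.
  move: (mean_curvature N X x) (laplacian _ _ x) (f _) (m%:R / 2).
  by move=> H L fK k E; lra.
Qed.
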